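(* Let $k\ge3$ and let $(q_m)_{m\ge1}$ be an increasing sequence of prime powers, $q_m=p_m^{e_m}$. For each $m$ let $S(k,q_m)=S(k,q_m;f_{3,m},g_{3,m},\ldots,f_{k,m},g_{k,m})$ with $g_{i,m}(0)=0$ for all $i$, and suppose $1\le d_f^{(m)}=o_m(q_m)$, $d_g^{(m)}=o_m(\sqrt{q_m})$ and $1\le d_g^{(m)}<p_m$ for all $m$. Let $\lambda^{(m)}$ be the largest eigenvalue of $S(k,q_m)$ different from $q_m(q_m-1)$. Then $\lambda^{(m)}=o_m(q_m^2)$.
   Context: For a prime power $q$, $k\ge3$, and $f_i,g_i\in\mathbb{F}_q[X]$ ($3\le i\le k$) of degree at most $q-1$ with $g_i(-X)=-g_i(X)$, $S(k,q;f_3,g_3,\ldots,f_k,g_k)$ is the simple graph on vertex set $\mathbb{F}_q^k$ in which $a$ and $b$ are adjacent iff $a_1\ne b_1$ and $b_i-a_i=g_i(b_1-a_1)f_i\!\left(\frac{b_2-a_2}{b_1-a_1}\right)$ for $3\le i\le k$; it is $q(q-1)$-regular. $d_f^{(m)}=\max_{3\le i\le k}\deg f_{i,m}$, $d_g^{(m)}=\max_{3\le i\le k}\deg g_{i,m}$. $f=o_m(g)$ means $f(m)/g(m)\to0$ as $m\to\infty$. Eigenvalues are those of the adjacency matrix. *)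

(* Defs.v *)
From HB Require Import structures.
From mathcomp Require Import all_boot all_order all_algebra all_field.
Set Implicit Arguments. Unset Strict Implicit. Unset Printing Implicit Defensive.
Import Order.TTheory GRing.Theory Num.Theory.
Local Open Scope ring_scope.

(* Vertices: row vectors in F^k, coordinates 0-indexed: coordinate 0 is a_1,
   coordinate 1 is a_2, coordinates i >= 2 are a_3 .. a_k. *)
Definition Sadj (F : finFieldType) (k : nat) (f g : 'I_k -> {poly F})
    (a b : 'rV[F]_k) : bool :=
  match k as k0 return ('I_k0 -> {poly F}) -> ('I_k0 -> {poly F}) ->
                       'rV[F]_k0 -> 'rV[F]_k0 -> bool with
  | k'.+2 => fun f g a b =>
      let d1 := b 0 0 - a 0 0 in
      let d2 := b 0 1 - a 0 1 in
      (d1 != 0) &&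
      [forall i : 'I_k'.+2, (2 <= (i : nat))%N ==>
         (b 0 i - a 0 i == (g i).[d1] * (f i).[d2 / d1])]
  | _ => fun _ _ _ _ => false
  end f g a b.

Definition Smx (F : finFieldType) (k : nat) (f g : 'I_k -> {poly F})
  : 'M[algC]_(#|{: 'rV[F]_k}|) :=
  \matrix_(i, j) ((Sadj f g (enum_val i) (enum_val j) : nat)%:R).

Definition largest_eig_except n (A : 'M[algC]_n) (d l : algC) : Prop :=
  [/\ eigenvalue A l, l != d &
      forall a, eigenvalue A a -> a != d -> a <= l].

Definition maxdeg (F : finFieldType) (k : nat) (f : 'I_k -> {poly F}) : nat :=
  (\max_(i : 'I_k | (2 <= (i : nat))%N) (size (f i)).-1)%N.

(* Main.v *)
Require Import Defs.
From HB Require Import structures.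
From mathcomp Require Import all_boot all_order all_fingroup all_algebra all_solvable all_field all_character.
From mathcomp Require Import zify ring.
Set Implicit Arguments. Unset Strict Implicit. Unset Printing Implicit Defensive.
Import Order.TTheory GRing.Theory Num.Theory.
Local Open Scope ring_scope.

(** The graph is a Cayley graph of the additive group F^k, so its eigenvalues are the sums
    lam_w = sum_t sum_(x != 0) psi (H_t(x)) with H_t = (w_1 + w_2 t) X + sum_i w_i f_i(t) g_i.
    Either every H_t vanishes, and lam_w = q (q - 1), or at most d_f of them do; the others
    have degree between 1 and d_g < p, where Weil's bound applies.  Hence
    |lam_w| <= d_f q + q d_g sqrt q.

    Weil's bound |sum_x psi (H(x))| <= (d - 1) sqrt q for p not dividing d = deg H is obtained
    in an algebraic closure K of F.  Put S_n = sum_(x in F_(q^n)) psi (Tr H(x)) and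
    c_n = sum_g psi (sum of H over the roots of g), g monic of degree n over F.  Then
    n c_n = sum_(1 <= j <= n) S_j c_(n - j), and c_n = 0 for n >= d, so S_n = - sum_i om_i ^ n
    for at most d - 1 numbers om_i.  Stepanov's method, applied to the points of the curve
    y ^ q - y = H(x) with x ^ Q = x and y ^ Q = y + c for Q = q ^ (2 m), gives
    |S_(2 m)| <= C q ^ m for large m, which forces |om_i| <= sqrt q. *)

(** * Zeros of functions on Artin-Schreier curves *)

(** The Chinese remainder [n < q * d] that is [w] mod [q] and [0] mod [d] supplies [d * b]; as
    [n < q * d <= w], the rest [w - n] is a nonnegative multiple of [q]. *)
Lemma coprime_weight_exists q d w : (0 < q)%N -> (0 < d)%N -> coprime q d -> (q * d <= w)%N ->
  exists a b, w = (q * a + d * b)%N.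
Proof.
move=> q_gt0 d_gt0 co_qd le_w; pose n := (chinese q d w 0 %% (q * d))%N.
have ltn : (n < q * d)%N by rewrite ltn_mod muln_gt0 q_gt0.
have /dvdnP[b Db] : (d %| n)%N.
  by rewrite /dvdn modn_dvdm ?dvdn_mull // chinese_modr // mod0n.
have nw : (n = w %[mod q])%N.
  by rewrite modn_dvdm ?dvdn_mulr // chinese_modl.
have : (q %| w - n)%N by rewrite -eqn_mod_dvd ?nw //; lia.
by case/dvdnP=> a Da; exists a, b; lia.
Qed.

Section CurveFunctions.
Variables (K : fieldType) (q d N : nat) (x y : 'I_N -> K).
Hypotheses (q_gt1 : (1 < q)%N) (d_gt0 : (0 < d)%N).

(* [x] and [y] have poles of order [q] and [d] at infinity; weights are pole orders. *)
Definition monom (a b : nat) : 'rV[K]_N := \row_i (x i ^+ a * y i ^+ b).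

(** Functions are represented by their rows of values at the [N] points, so linear relations here
    are relations on the point set. As [q] and [d] are positive, bounding both exponents by [w]
    loses no monomial. *)
Definition weight_lt (w : nat) : 'M[K]_N :=
  (\sum_(ab : 'I_w * 'I_w | (q * ab.1 + d * ab.2 < w)%N)
     <<monom ab.1 ab.2>>)%MS.

Lemma monom_weight_lt a b w :
  (q * a + d * b < w)%N -> (monom a b <= weight_lt w)%MS.
Proof.
move=> lt_w.
have lt_a : (a < w)%N by nia.
have lt_b : (b < w)%N by nia.
by rewrite (sumsmx_sup (Ordinal lt_a, Ordinal lt_b)) ?genmxE.
Qed.

Lemma weight_lt_sub w n (B : 'M[K]_(n, N)) :
  (forall a b, (q * a + d * b < w)%N -> (monom a b <= B)%MS) ->
  (weight_lt w <= B)%MS.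
Proof. by move=> sB; apply/sumsmx_subP=> ab ?; rewrite genmxE sB. Qed.

Lemma weight_ltS w w' : (w <= w')%N -> (weight_lt w <= weight_lt w')%MS.
Proof.
by move=> le_w; apply: weight_lt_sub => a b ?; apply/monom_weight_lt/(leq_trans _ le_w).
Qed.

Lemma monomM a b a' b' :
  monom a b *m diag_mx (monom a' b') = monom (a + a') (b + b').
Proof. by apply/rowP=> i; rewrite mul_mx_diag !mxE !exprD mulrACA. Qed.

Lemma weight_ltM a b w n (A : 'M[K]_(n, N)) : (A <= weight_lt w)%MS ->
  (A *m diag_mx (monom a b) <= weight_lt (w + (q * a + d * b)))%MS.
Proof.
move=> sA; apply: (submx_trans (submxMr _ sA)).
rewrite sumsmxMr; apply/sumsmx_subP=> -[[a' ?] [b' ?]] /= lt_w.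
rewrite (eqmxMr _ (genmxE _)) monomM monom_weight_lt //; lia.
Qed.

Definition eq_mod_lower w (u v : 'rV[K]_N) :=
  exists2 c, c != 0 & (u - c *: v <= weight_lt w)%MS.

Lemma eq_mod_lower_refl w u : eq_mod_lower w u u.
Proof. by exists 1; rewrite ?oner_eq0 // scale1r subrr sub0mx. Qed.

Lemma eq_mod_lower_sym w u v : eq_mod_lower w u v -> eq_mod_lower w v u.
Proof.
case=> c nz_c sub; exists c^-1; rewrite ?invr_eq0 //.
rewrite -(eqmx_scale _ nz_c) scalerBr scalerA divff // scale1r.
by rewrite -opprB -scaleN1r scalemx_sub.
Qed.

Lemma eq_mod_lower_trans w v u t :
  eq_mod_lower w u v -> eq_mod_lower w v t -> eq_mod_lower w u t.
Proof.
case=> c nz_c suv [e nz_e svt]; exists (c * e); rewrite ?mulf_neq0 //.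
rewrite -[u](subrK (c *: v)) -addrA addmx_sub //.
by rewrite -scalerA -scalerBr scalemx_sub.
Qed.

Lemma eq_mod_lower_sub w u v n (B : 'M[K]_(n, N)) :
  eq_mod_lower w u v -> (weight_lt w <= B)%MS -> (v <= B)%MS -> (u <= B)%MS.
Proof.
case=> c _ suv sB svB; rewrite -[u](subrK (c *: v)) addmx_sub ?scalemx_sub //.
exact: submx_trans suv sB.
Qed.

Variable H : {poly K}.
Hypotheses (co_qd : coprime q d) (size_H : size H = d.+1).
Hypothesis inj_xy : forall i j, x i = x j -> y i = y j -> i = j.
Hypothesis curve_xy : forall i, y i ^+ q = y i + H.[x i].

(** Replacing [y ^ q] by [y + H(x)] leaves the leading term of [H(x)], of the same weight [q * d] as
    [y ^ q]; all other terms are lighter. *)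
Lemma monom_reduce a b :
  eq_mod_lower (q * a + d * b + q * d) (monom a (b + q)) (monom (a + d) b).
Proof.
exists H`_d.
  by rewrite -[d]/(d.+1.-1) -size_H -lead_coefE lead_coef_eq0 -size_poly_gt0 size_H.
have -> : monom a (b + q) - H`_d *: monom (a + d) b =
    monom a b.+1 + \sum_(k < d) H`_k *: monom (a + k) b.
  apply/rowP=> i; rewrite !mxE summxE exprD curve_xy horner_coef size_H.
  under [in RHS]eq_bigr => k _ do rewrite !mxE exprD.
  have -> : \sum_(k < d) H`_k * (x i ^+ a * x i ^+ k * y i ^+ b) =
      x i ^+ a * y i ^+ b * \sum_(k < d) H`_k * x i ^+ k.
    by rewrite mulr_sumr; apply: eq_bigr => k _; ring.
  by rewrite big_ord_recr /= exprS exprD; ring.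
rewrite addmx_sub ?monom_weight_lt //; first by nia.
apply: summx_sub => k _; rewrite scalemx_sub // monom_weight_lt //.
by have := ltn_ord k; nia.
Qed.

(** Coprimality forces the exponents of [y] to differ by a multiple [k * q], so [k] uses of
    [monom_reduce] turn one monomial into the other. *)
Lemma eq_weight_monom a b a' b' :
  (q * a + d * b = q * a' + d * b')%N ->
  eq_mod_lower (q * a + d * b) (monom a b) (monom a' b').
Proof.
wlog le_b : a b a' b' / (b' <= b)%N => [hw eq_w|].
  have [|/ltnW] := leqP b' b; first by move/hw; apply.
  by move=> /hw/(_ (esym eq_w))/eq_mod_lower_sym; rewrite eq_w.
move=> eq_w; have /dvdnP[k Dk] : (q %| b - b')%N.
  rewrite -(Gauss_dvdr _ co_qd) mulnBr.
  have -> : (d * b - d * b' = q * (a' - a))%N by nia.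
  exact: dvdn_mulr.
have Db : (b = b' + k * q)%N by lia.
have Da : (a' = a + k * d)%N by nia.
move: eq_w; rewrite {}Da {}Db => {le_b Dk a' b} _.
elim: k a => [|k IHk] a; first by rewrite !addn0; apply: eq_mod_lower_refl.
have -> : (b' + k.+1 * q = b' + k * q + q)%N by lia.
apply: (@eq_mod_lower_trans _ (monom (a + d) (b' + k * q))).
  have -> : (q * a + d * (b' + k * q + q) = q * a + d * (b' + k * q) + q * d)%N.
    by lia.
  exact: monom_reduce.
have := IHk (a + d)%N; rewrite -addnA -mulSn.
by congr eq_mod_lower; lia.
Qed.

(** By [eq_weight_monom] each weight adds at most one dimension. *)
Lemma rank_weight_lt w : (\rank (weight_lt w) <= w)%N.
Proof.
elim: w => [|w IHw].
  by rewrite /weight_lt big_pred0 ?mxrank0 // => -[[? lt]].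
case: (pickP (fun ab : 'I_w.+1 * 'I_w.+1 => w == (q * ab.1 + d * ab.2)%N)).
  move=> [a b] /= /eqP Dw.
  have sub : (weight_lt w.+1 <= weight_lt w + monom a b)%MS.
    apply: weight_lt_sub => a' b'; rewrite ltnS leq_eqVlt => /orP[/eqP eq_w|lt_w].
      apply: (eq_mod_lower_sub (@eq_weight_monom _ _ a b _)).
      - by rewrite eq_w.
      - by rewrite eq_w addsmxSl.
      - exact: addsmxSr.
    by rewrite (submx_trans (monom_weight_lt lt_w)) // addsmxSl.
  apply: (leq_trans (mxrankS sub)); apply: (leq_trans (mxrank_adds_leqif _ _)).
  by rewrite -[X in (_ <= X)%N]addn1 leq_add // rank_leq_row.
move=> no; apply: leq_trans (leqW IHw); apply: mxrankS.
apply: weight_lt_sub => a b; rewrite ltnS leq_eqVlt => /orP[/eqP eq_w|].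
  have lt_a : (a < w.+1)%N by nia.
  have lt_b : (b < w.+1)%N by nia.
  by have := no (Ordinal lt_a, Ordinal lt_b); rewrite /= eq_w eqxx.
exact: monom_weight_lt.
Qed.

(** Starting from the constant [1], multiplication by [x - x j] or by [y - y j], whichever is
    nonzero at the point [i], kills the other points one at a time. *)
Lemma delta_weight_lt i : exists w, ((delta_mx 0 i : 'rV[K]_N) <= weight_lt w)%MS.
Proof.
suff step (s : seq 'I_N) : exists w (v : 'rV[K]_N), [/\ (v <= weight_lt w)%MS,
    v 0 i != 0 & forall j, j \in s -> j != i -> v 0 j = 0].
  have [w [v [sv nz_v v0]]] := step (enum 'I_N); exists w.
  suff -> : delta_mx 0 i = (v 0 i)^-1 *: v by rewrite scalemx_sub.
  apply/rowP=> j; rewrite !mxE eqxx /=; have [->|ne_ji] := eqVneq j i.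
    by rewrite mulVf.
  by rewrite (v0 j (mem_enum _ _) ne_ji) mulr0.
elim: s => [|j s [w [v [sv nz_v v0]]]].
  exists 1%N, (monom 0 0); split => //.
    by apply: monom_weight_lt; rewrite !muln0.
  by rewrite mxE !expr0 mulr1 oner_eq0.
have [eq_ji|ne_ji] := eqVneq j i.
  exists w, v; split=> // k; rewrite inE => /orP[/eqP-> | /v0//].
  by rewrite eq_ji eqxx.
have Mdiag (u : 'rV[K]_N) c k :
    (v *m diag_mx u - c *: v) 0 k = v 0 k * (u 0 k - c).
  by rewrite mul_mx_diag !mxE mulrBr [c * _]mulrC.
have sub a b c :
    (v *m diag_mx (monom a b) - c *: v <= weight_lt (w + (q * a + d * b)))%MS.
  rewrite addmx_sub ?weight_ltM // -scaleNr scalemx_sub //.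
  by rewrite (submx_trans sv) // weight_ltS // leq_addr.
have [eq_x|ne_x] := eqVneq (x i) (x j); last first.
  exists (w + (q * 1 + d * 0))%N, (v *m diag_mx (monom 1 0) - x j *: v); split=> //.
    by rewrite Mdiag mxE expr0 mulr1 expr1 mulf_neq0 ?subr_eq0.
  move=> k; rewrite Mdiag mxE expr0 mulr1 expr1 inE => /orP[/eqP-> | s_k ne_k].
    by rewrite subrr mulr0.
  by rewrite v0 ?mul0r.
have ne_y : y i != y j by apply: contra_neq ne_ji => eq_y; apply/esym/inj_xy.
exists (w + (q * 0 + d * 1))%N, (v *m diag_mx (monom 0 1) - y j *: v); split=> //.
  by rewrite Mdiag mxE expr0 mul1r expr1 mulf_neq0 ?subr_eq0.
move=> k; rewrite Mdiag mxE expr0 mul1r expr1 inE => /orP[/eqP-> | s_k ne_k].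
  by rewrite subrr mulr0.
by rewrite v0 ?mul0r.
Qed.

Lemma weight_lt_full : exists w, (1%:M <= weight_lt w)%MS.
Proof.
suff [w sw] : exists w, forall i, ((delta_mx 0 i : 'rV[K]_N) <= weight_lt w)%MS.
  by exists w; apply/row_subP=> i; rewrite row1.
suff [w sw] : exists w, forall i, i \in enum 'I_N -> ((delta_mx 0 i : 'rV[K]_N) <= weight_lt w)%MS.
  by exists w => i; rewrite sw ?mem_enum.
elim: (enum _) => [|i s [w sw]]; first by exists 0.
have [w' sw'] := delta_weight_lt i; exists (maxn w w') => j.
rewrite inE => /orP[/eqP-> | s_j].
  by rewrite (submx_trans sw') // weight_ltS ?leq_maxr.
by rewrite (submx_trans (sw _ s_j)) // weight_ltS ?leq_maxl.
Qed.

(* The functions on the zero set are spanned by one monomial of minimal weight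
   in each residue class modulo the weight of the leading monomial. *)
Lemma card_zeros_le I J : (monom I J <= weight_lt (q * I + d * J))%MS ->
  (N <= q * I + d * J)%N.
Proof.
set W := (q * I + d * J)%N => sIJ.
have [W0|W_gt0] := posnP W.
  rewrite {1}W0 /weight_lt big_pred0 in sIJ; last by case=> -[].
  have mon1 : monom I J = const_mx 1.
    have [-> ->] : I = 0%N /\ J = 0%N by split; nia.
    by apply/rowP=> i; rewrite !mxE !expr0 mulr1.
  move: sIJ; rewrite submx0 mon1 => /eqP one0.
  case: (posnP N) => [->//|N_gt0].
  have /rowP/(_ (Ordinal N_gt0)) := one0.
  by rewrite !mxE => /eqP; rewrite oner_eq0.
(* Multiplying [sIJ] by a monomial shows that a monomial whose weight is [W] more than the weight of
   another one is a combination of lighter monomials. *)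
have red a b a' b' : (q * a + d * b = W + (q * a' + d * b'))%N ->
    (monom a b <= weight_lt (q * a + d * b))%MS.
  move=> eq_w.
  have eq_w' : (q * a + d * b = q * (I + a') + d * (J + b'))%N by rewrite eq_w; lia.
  apply: (eq_mod_lower_sub (eq_weight_monom eq_w')) => //.
  by rewrite -monomM eq_w weight_ltM.
pose P (r : 'I_W) w := [exists ab : 'I_w.+1 * 'I_w.+1,
  ((q * ab.1 + d * ab.2)%N == w) && (w %% W == r)%N].
have PP (r : 'I_W) w : reflect (exists a b, (q * a + d * b = w)%N /\ (w %% W = r)%N) (P r w).
  apply: (iffP existsP) => [[[a b] /= /andP[/eqP ? /eqP ?]]|[a [b [Dw Dr]]]].
    by exists a, b.
  have lt_a : (a < w.+1)%N by nia.
  have lt_b : (b < w.+1)%N by nia.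
  by exists (Ordinal lt_a, Ordinal lt_b); rewrite /= Dw Dr !eqxx.
have [wf full] := weight_lt_full.
(* [T r] is a monomial of least weight in the class [r], or [0] if no monomial of weight below [wf]
   lies in that class. *)
have [T sT] : exists T : 'I_W -> 'rV[K]_N, forall r w, (w < wf)%N -> P r w ->
   exists a b, [/\ T r = monom a b, (q * a + d * b <= w)%N
      & (w = q * a + d * b %[mod W])%N].
  pose Pr (r : 'I_W) (t : 'rV[K]_N) := forall w, (w < wf)%N -> P r w ->
    exists a b, [/\ t = monom a b, (q * a + d * b <= w)%N
      & (w = q * a + d * b %[mod W])%N].
  suff /fin_all_exists : forall r, exists t, Pr r t by [].
  move=> r.
  case: (pickP (fun w : 'I_wf => P r w)) => [w0 Pw0|no].
    have [w1 /PP[a [b [Dw1 Dr]]] min1] := ex_minnP (ex_intro _ (w0 : nat) Pw0).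
    exists (monom a b) => w _ /[dup] /min1 le_w /PP[a' [b' [Dw Dr']]].
    by exists a, b; split; rewrite ?Dw1 // Dr' Dr.
  by exists 0 => w lt_w; rewrite (no (Ordinal lt_w)).
have sub w : (w <= wf)%N -> (weight_lt w <= \sum_(r < W) <<T r>>)%MS.
  elim: w => [|w IHw] lt_wf; first by apply: weight_lt_sub.
  apply: weight_lt_sub => a b; rewrite ltnS leq_eqVlt => /orP[/eqP eq_w|lt_w]; last first.
    exact: (submx_trans (monom_weight_lt lt_w) (IHw (ltnW lt_wf))).
  have lt_r : (w %% W < W)%N by rewrite ltn_mod.
  have [|a0 [b0 [DT le0 eq0]]] := sT (Ordinal lt_r) w lt_wf.
    by apply/PP; exists a, b.
  have : (W %| w - (q * a0 + d * b0))%N by rewrite -eqn_mod_dvd // eq0.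
  (* Either [w] is least in its class, or it exceeds the least weight by [k.+1] times [W]; then
     [red] applies with the least monomial times the [k]-th power of [monom I J]. *)
  case/dvdnP=> -[|k] Dk.
    have eq_w' : (q * a + d * b = q * a0 + d * b0)%N by lia.
    apply: (eq_mod_lower_sub (eq_weight_monom eq_w')).
      by rewrite eq_w IHw // ltnW.
    by rewrite -DT (sumsmx_sup (Ordinal lt_r)) ?genmxE.
  apply: (submx_trans (red a b (a0 + k * I)%N (b0 + k * J)%N _)).
    have : (w = k.+1 * W + (q * a0 + d * b0))%N by lia.
    by rewrite eq_w => ->; rewrite /W; nia.
  by rewrite eq_w IHw // ltnW.
have := mxrankS (submx_trans full (sub wf (leqnn _))); rewrite mxrank1 => /leq_trans-> //.
apply: leq_trans (mxrank_sum_leqif _).1 _.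
rewrite -[X in (_ <= X)%N]card_ord -sum1_card leq_sum // => r _ /=.
by rewrite genmxE rank_leq_row.
Qed.

End CurveFunctions.

(** * Stepanov's bound for the number of points *)

Section Stepanov.
Variables (K : closedFieldType) (q d N : nat) (H : {poly K}) (x y : 'I_N -> K).
Hypotheses (q_gt1 : (1 < q)%N) (d_gt0 : (0 < d)%N) (co_qd : coprime q d).
Hypothesis size_H : size H = d.+1.
Hypothesis inj_xy : forall i j, x i = x j -> y i = y j -> i = j.
Hypothesis curve_xy : forall i, y i ^+ q = y i + H.[x i].
Variables (c : K) (R : nat).
Hypothesis R_large : ((q * d).*2.+1 < R)%N.
Hypothesis frobR : forall a b : K, (a + b) ^+ R = a ^+ R + b ^+ R.
Hypothesis x_frob : forall i, x i ^+ (R * R) = x i.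
Hypothesis y_frob : forall i, y i ^+ (R * R) = y i + c.

Local Notation monom := (monom x y).
Local Notation weight_lt := (weight_lt q d x y).

Lemma frob_sum I (r : seq I) (P : pred I) (f : I -> K) :
  (\sum_(i <- r | P i) f i) ^+ R = \sum_(i <- r | P i) f i ^+ R.
Proof.
apply: (big_morph (fun z => z ^+ R)) => //.
by rewrite expr0n; case: R R_large.
Qed.

Lemma root_exists (z : K) : exists t, t ^+ R = z.
Proof.
have /closed_rootP[t] : size ('X^R - z%:P) != 1%N.
  by rewrite size_XnsubC ?eqSS; lia.
by rewrite /root !hornerE subr_eq0 => /eqP; exists t.
Qed.

(* Stepanov's auxiliary function is [h = sum_t be_t * e_u * e_v ^ R], with [e_u], [e_v]
   monomials of weights [u < R] and [v].  At the given points its [R]-th power is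
   [sum_t be_t ^ R * (e_u ^ R) (x, y) * e_v (x, y + c)], which has much smaller weight,
   so linear algebra makes it vanish; as [u < R], all weights in [h] are distinct. *)
Lemma card_points_le : (N <= R * R + (3 * (q * d) + 2) * R)%N.
Proof.
(* This [s] makes the number [(R - G) * s] of products exceed the weight bound [w] below: the
   difference is [(G + 2) * (R - 2 * G - 1)], positive by [R_large]. *)
set G := (q * d)%N; pose s := (R + G.*2 + 2)%N.
(* Both families of weights start at [G], from where on every integer is the weight of some
   monomial. *)
have wex n : forall i : 'I_n, exists ab : nat * nat,
    (G + i = q * ab.1 + d * ab.2)%N.
  move=> i; have [//|a [b Dab]] := coprime_weight_exists (ltnW q_gt1) d_gt0 co_qd (w := (G + i)%N).
    by rewrite leq_addr.
  by exists (a, b).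
have [A DA] := fin_all_exists (wex (R - G)%N).
have [B DB] := fin_all_exists (wex s).
pose T := ('I_(R - G) * 'I_s)%type.
pose vec (t : T) := \row_i ((x i ^+ (R * (A t.1).1) * y i ^+ (R * (A t.1).2)) *
   (x i ^+ (B t.2).1 * (y i + c) ^+ (B t.2).2)).
pose w := (R * R.-1 + G + s)%N.
have vec_sub t : (vec t <= weight_lt w)%MS.
  have -> : vec t = \sum_(k < (B t.2).2.+1)
      (c ^+ k *+ 'C((B t.2).2, k)) *:
        monom (R * (A t.1).1 + (B t.2).1) (R * (A t.1).2 + ((B t.2).2 - k)).
    apply/rowP=> i; rewrite !mxE summxE exprDn 2!mulr_sumr.
    have shuffle (a b a' e f : K) m : (a * b) * (a' * (e * f *+ m)) =
        (f *+ m) * (a * a' * (b * e)).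
      by rewrite -[e * f *+ m]mulr_natr -[f *+ m]mulr_natr; ring.
    by apply: eq_bigr => k _; rewrite !mxE !exprD shuffle.
  apply: summx_sub => k _; rewrite scalemx_sub // monom_weight_lt //.
  move: (nat_of_ord k) => {}k.
  have := DA t.1; have := DB t.2; have := ltn_ord t.1; have := ltn_ord t.2.
  rewrite /w /s; move: (A _) (B _) => [a1 b1] [a2 b2] /=.
  move: (nat_of_ord t.1) (nat_of_ord t.2) => i j lt_j lt_i Dj Di.
  have leR : (R * (G + i) <= R * R.-1)%N.
    by rewrite leq_mul2l (_ : (G + i <= R.-1)%N) ?orbT //; lia.
  have le_k : (d * (b2 - k) <= d * b2)%N by rewrite leq_mul2l leq_subr orbT.
  have -> : (q * (R * a1 + a2) + d * (R * b1 + (b2 - k)) =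
      R * (q * a1 + d * b1) + q * a2 + d * (b2 - k))%N by ring.
  by rewrite -Di; lia.
pose M := \matrix_(i < #|{: T}|) vec (enum_val i).
have lt_w : (w < #|{: T}|)%N.
  rewrite card_prod !card_ord /w /s.
  have : (G.*2.+1 < R)%N by [].
  case: (R) => // r; rewrite -/G /= => ltr.
  by nia.
have [al al_nz alM] : exists2 al : 'rV[K]_#|{: T}|, al != 0 & al *m M = 0.
  suff : kermx M != 0.
    by case/rowV0Pn=> al /sub_kermxP ? ?; exists al.
  rewrite kermx_eq0 /row_free; apply: contraTneq lt_w => <-; rewrite -leqNgt.
  apply: leq_trans (rank_weight_lt q_gt1 d_gt0 co_qd size_H curve_xy w).
  by apply/mxrankS/row_subP=> i; rewrite rowK.
(* As [K] is algebraically closed and [R]-th powers are additive, taking [R]-th roots of the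
   coefficients turns the vanishing combination of the rows [vec t] into a vanishing [h]. *)
have [be Dbe] := fin_all_exists (fun t : T => root_exists (al 0 (enum_rank t))).
pose u (t : T) := monom ((A t.1).1 + R * (B t.2).1) ((A t.1).2 + R * (B t.2).2).
have h0 : \sum_t be t *: u t = 0.
  apply/rowP=> i; rewrite summxE mxE.
  apply/eqP; have : (\sum_t (be t *: u t) 0 i) ^+ R == 0.
    rewrite frob_sum; apply/eqP.
    have /rowP/(_ i) := alM; rewrite !mxE => Mi; rewrite -[RHS]Mi.
    rewrite [RHS](reindex enum_rank) /=; last exact/onW_bij/enum_rank_bij.
    apply: eq_bigr => t _.
    rewrite !mxE enum_rankK -Dbe !exprMn -!exprM !mulnDl !exprD.
    have expRR (z : K) n : z ^+ (R * n * R) = (z ^+ (R * R)) ^+ n.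
      by rewrite -exprM; congr (_ ^+ _); nia.
    rewrite !expRR x_frob y_frob ![(R * _)%N]mulnC.
    by ring.
  by rewrite expf_eq0 => /andP[].
have [t0 be0] : exists t, be t != 0.
  have /rV0Pn[j] := al_nz; rewrite -[j]enum_valK -Dbe expf_eq0 negb_and.
  case/orP=> [|nz]; first by lia.
  by exists (enum_val j).
pose wt (t : T) := ((G + t.1) + R * (G + t.2))%N.
have Dwt t : wt t = (q * ((A t.1).1 + R * (B t.2).1) + d * ((A t.1).2 + R * (B t.2).2))%N.
  by rewrite /wt DA DB; ring.
have [t1 be1 max1] := @arg_maxnP T t0 (fun t => be t != 0) wt be0.
(* Since [G + t.1 < R], remainder and quotient of the weight modulo [R] recover both indices. *)
have wt_inj t t' : wt t = wt t' -> t = t'.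
  have ltT (i : 'I_(R - G)) : (G + i < R)%N by have := ltn_ord i; lia.
  move=> eq_wt; have /(congr1 (modn^~ R)) := eq_wt.
  have /(congr1 (divn^~ R)) := eq_wt.
  have R_gt0 : (0 < R)%N by lia.
  rewrite /wt ![(_ + R * _)%N]addnC ![(R * _)%N]mulnC !divnMDl // !modnMDl.
  rewrite !modn_small // !divn_small // !addn0 => /addnI eq2 /addnI eq1.
  by case: t t' eq1 eq2 {eq_wt} => [? ?] [? ?] /= /val_inj-> /val_inj->.
have leW : (wt t1 <= R * R + (3 * G + 2) * R)%N.
  move: (ltn_ord t1.1) (ltn_ord t1.2); rewrite /wt /s.
  move: (nat_of_ord t1.1) (nat_of_ord t1.2) => i j lt_i lt_j.
  have : (R * (G + j) <= R * (R + 3 * G + 1))%N.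
    by rewrite leq_mul2l (_ : (G + j <= R + 3 * G + 1)%N) ?orbT //; lia.
  by lia.
apply: leq_trans leW; rewrite Dwt.
apply: (card_zeros_le q_gt1 d_gt0 co_qd size_H inj_xy curve_xy).
rewrite -Dwt -/(u t1).
(* The relation [h0] expresses the heaviest monomial by strictly lighter ones, as [card_zeros_le]
   requires. *)
have -> : u t1 = - (be t1)^-1 *: \sum_(t | t != t1) be t *: u t.
  move: h0; rewrite (bigD1 t1) //= => /eqP; rewrite addr_eq0 => /eqP eq1.
  by rewrite scaleNr -scalerN -eq1 scalerA mulVf ?scale1r.
rewrite scalemx_sub //; apply: summx_sub => t ne_t1.
have [->|be_t] := eqVneq (be t) 0; first by rewrite scale0r sub0mx.
rewrite scalemx_sub // monom_weight_lt // -Dwt ltn_neqAle (max1 t be_t : _ <= _)%N andbT.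
by apply: contra_neq ne_t1 => /wt_inj.
Qed.
End Stepanov.

(** * Frobenius on an algebraic closure *)

Lemma finField_card_pow (F : finFieldType) : exists p e,
  [/\ p \in [pchar F], (0 < e)%N & #|F| = (p ^ e)%N].
Proof.
have [p pr_p charFp] := finPcharP F.
have := pprimeChar_pgroup charFp; rewrite /pgroup cardsT /= => /p_natP[e De].
have {}De : #|F| = (p ^ e)%N := De.
exists p, e; split=> //; rewrite lt0n; apply: contraTneq (finNzRing_gt1 F) => e0.
by rewrite De e0.
Qed.

(* The embedding [iota] is an argument because it is what makes the power map additive. *)
Definition frob (F : finFieldType) (K : closedFieldType) (iota : {rmorphism F -> K})
  (z : K) := z ^+ #|F|.

Section Frobenius.
Variables (F : finFieldType) (K : closedFieldType) (iota : {rmorphism F -> K}).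
Local Notation q := #|F|.
Local Notation frob := (frob iota).

Lemma card_pchar_nat : [pchar K].-nat q.
Proof.
have [p [e [charFp _ ->]]] := finField_card_pow F.
rewrite pnatX pnatE ?(pcharf_prime charFp) //.
by rewrite (rmorph_pchar iota charFp).
Qed.

Lemma expfD_card n (a b : K) : (a + b) ^+ (q ^ n) = a ^+ (q ^ n) + b ^+ (q ^ n).
Proof. by apply: exprDn_pchar; rewrite pnatX card_pchar_nat. Qed.

Lemma card_natr_eq0 : q%:R = 0 :> K.
Proof.
have [p [e [charFp e_gt0 ->]]] := finField_card_pow F.
by rewrite natrX (pcharf0 (rmorph_pchar iota charFp)) expr0n eqn0Ngt e_gt0.
Qed.

Fact frob_is_zmod_morphism : zmod_morphism frob.
Proof.
have fD (a b : K) : frob (a + b) = frob a + frob b by exact: (expfD_card 1).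
by move=> a b; apply: (addIr (frob b)); rewrite -fD !subrK.
Qed.
Fact frob_is_monoid_morphism : monoid_morphism frob.
Proof. by split=> [|a b]; rewrite /frob ?expr1n ?exprMn. Qed.

HB.instance Definition _ :=
  GRing.isZmodMorphism.Build K K frob frob_is_zmod_morphism.
HB.instance Definition _ :=
  GRing.isMonoidMorphism.Build K K frob frob_is_monoid_morphism.

Lemma frob_iter n z : iter n frob z = z ^+ (q ^ n).
Proof. by elim: n => [|n IHn]; rewrite ?expn0 // iterS IHn /frob -exprM -expnSr. Qed.

Lemma frobK_iota a : frob (iota a) = iota a.
Proof. by rewrite /frob -rmorphXn expf_card. Qed.

Lemma frob_fixedP z : reflect (exists a, z = iota a) (frob z == z).
Proof.
apply: (iffP eqP) => [fz|[a ->]]; last exact: frobK_iota.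
have : root (map_poly iota ('X^q - 'X)) z.
  by rewrite /root rmorphB /= map_polyXn map_polyX !hornerE /= -/(frob z) fz subrr.
rewrite finField_genPoly rmorph_prod rootE horner_prod => /prodf_eq0[a _].
by rewrite /= map_polyXsubC hornerXsubC subr_eq0 => /eqP->; exists a.
Qed.

(** Serves twice: for [N = q] and [z = H(x)] these are the ordinates of the curve above [x]; for
    [N = q ^ n] and [z = 0] they form the extension of [F] of degree [n] inside [K]. *)
Definition asroots (N : nat) (z : K) : seq K :=
  sval (closed_field_poly_normal ('X^N - 'X - z%:P)).

Lemma asroots_spec N z : (1 < N)%N -> N%:R = 0 :> K ->
  [/\ uniq (asroots N z), size (asroots N z) = N
    & forall y, (y \in asroots N z) = (y ^+ N == y + z)].
Proof.
move=> N_gt1 N0; rewrite /asroots; case: closed_field_poly_normal => r /= Dr.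
have szP : size ('X^N - 'X - z%:P) = N.+1.
  rewrite -addrA size_polyDl ?size_polyXn // ltnS -opprD size_polyN.
  by rewrite (leq_trans (size_polyD _ _)) // size_polyX size_polyC geq_max N_gt1; case: eqP; lia.
have mon : 'X^N - 'X - z%:P \is monic.
  rewrite monicE -addrA lead_coefDl ?lead_coefXn // size_polyXn ltnS -opprD size_polyN.
  by rewrite (leq_trans (size_polyD _ _)) // size_polyX size_polyC geq_max N_gt1; case: eqP; lia.
rewrite (monicP mon) scale1r in Dr.
split.
- rewrite -separable_prod_XsubC -Dr unlock.
  have N0p : N%:R = 0 :> {poly K} by rewrite -polyC_natr N0.
  rewrite !derivE -mulr_natr N0p mulr0 subr0 sub0r -[X in coprimep _ X]scaleN1r.
  by rewrite coprimepZr ?oppr_eq0 ?oner_eq0 ?coprimep1.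
- by apply/succn_inj; rewrite -(size_prod_XsubC _ id) -Dr.
by move=> y; rewrite -root_prod_XsubC -Dr /root !hornerE subr_eq0 subr_eq addrC.
Qed.

Definition pts n := asroots (q ^ n) 0.

Lemma pts_spec n : (0 < n)%N -> [/\ uniq (pts n), size (pts n) = (q ^ n)%N
    & forall x, (x \in pts n) = (iter n frob x == x)].
Proof.
move=> n_gt0; have q_gt1 := finNzRing_gt1 F.
case: (@asroots_spec (q ^ n) 0) => [||? ? mem].
- by rewrite (leq_trans q_gt1) // -[X in (X <= _)%N]expn1 leq_exp2l.
- by rewrite natrX card_natr_eq0 expr0n eqn0Ngt n_gt0.
by split=> // x; rewrite mem addr0 frob_iter.
Qed.

(** This is the trace to [F] when [z] lies in [pts n]. *)
Definition tr n z := \sum_(i < n) iter i frob z.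

End Frobenius.

(** * Character sums over extensions of the base field *)

Section CharacterSums.
Variables (F : finFieldType) (K : closedFieldType) (iota : {rmorphism F -> K}).
Local Notation q := #|F|.
Local Notation frob := (frob iota).
Local Notation pts := (@pts F K).
Variable psi : F -> algC.
Hypothesis psiD : forall a b, psi (a + b) = psi a * psi b.
Hypothesis psi_norm : forall a, `|psi a| = 1.
Hypothesis psi_nontriv : exists a, psi a != 1.
Variables (H : {poly F}) (d : nat).
Hypotheses (size_H : size H = d.+1) (d_gt0 : (0 < d)%N) (co_qd : coprime q d).
Local Notation HK := (map_poly iota H).
Local Notation tr := (tr iota).

Lemma psi_neq0 a : psi a != 0.
Proof. by rewrite -normr_eq0 psi_norm oner_eq0. Qed.

Lemma psi0 : psi 0 = 1.
Proof. by apply: (mulfI (psi_neq0 0)); rewrite -psiD addr0 mulr1. Qed.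

Lemma sum_psi_eq0 : \sum_a psi a = 0.
Proof.
have [b ne1] := psi_nontriv.
have /eqP : psi b * \sum_a psi a = \sum_a psi a.
  rewrite mulr_sumr [RHS](reindex_inj (addrI b)).
  by apply: eq_bigr => a _; rewrite psiD.
rewrite -subr_eq0 -[X in _ - X]mul1r -mulrBl mulf_eq0 subr_eq0 (negPf ne1).
by move/eqP.
Qed.

(** Inverse of [iota] on its image; the default [0] elsewhere carries no meaning. *)
Definition descend (z : K) : F := odflt 0 [pick a | iota a == z].

Lemma descendK a : descend (iota a) = a.
Proof.
rewrite /descend; case: pickP => [b /eqP/fmorph_inj //|/(_ a)].
by rewrite eqxx.
Qed.

Definition ext_char z := psi (descend z).

Lemma frob_horner z : frob HK.[z] = HK.[frob z].
Proof.
rewrite -horner_map; congr (_.[_]); rewrite -map_poly_comp.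
by apply: eq_map_poly => a /=; apply: frobK_iota.
Qed.

Lemma iter_frob_horner n z : iter n frob HK.[z] = HK.[iter n frob z].
Proof. by elim: n => //= n ->; rewrite frob_horner. Qed.

Definition ext_charsum n := \sum_(x <- pts n) ext_char (tr n HK.[x]).

Lemma tr_fixed n z : iter n frob z = z -> frob (tr n z) = tr n z.
Proof.
move=> fz; rewrite /tr rmorph_sum /=; case: n fz => [|n] fz; first by rewrite !big_ord0.
rewrite big_ord_recr big_ord_recl /= -iterS fz addrC; congr (_ + _).
Qed.

(** Each further Frobenius adds the next conjugate of [z]. For [z = H(x)] of trace [c] this gives
    the condition [y ^ Q = y + c] of Stepanov's count. *)
Lemma artin_schreier_iter n y z : y ^+ q = y + z -> iter n frob y = y + tr n z.
Proof.
move=> yq; elim: n => [|n IHn]; first by rewrite /tr big_ord0 addr0.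
rewrite iterSr [frob y]yq; have -> : iter n frob (y + z) = iter n frob y + iter n frob z.
  by elim: (n) => //= m ->; rewrite rmorphD.
by rewrite IHn -addrA /tr big_ord_recr.
Qed.

(** Above each counted [x] lie [q] points of the curve, which gives the factor [q]. The degree is
    even so that [Q = q ^ m.*2] is the square of [R = q ^ m]. *)
Lemma fiber_card_le m c : ((q * d).*2.+1 < q ^ m)%N ->
  (q * count (fun x => tr m.*2 HK.[x] == iota c) (pts m.*2) <=
    q ^ m * q ^ m + (3 * (q * d) + 2) * q ^ m)%N.
Proof.
move=> q_large; set n := m.*2.
have q_gt1 := finNzRing_gt1 F.
have n_gt0 : (0 < n)%N.
  by rewrite double_gt0 lt0n; apply: contraTneq q_large => ->; rewrite expn0; lia.
have [Upts _ mem_pts] := pts_spec iota n_gt0.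
have as_spec z := asroots_spec z q_gt1 (card_natr_eq0 iota).
pose P := [seq x <- pts n | tr n HK.[x] == iota c].
pose Z := [seq (x, y) | x <- P, y <- asroots q HK.[x]].
have szZ : size Z = (q * count (fun x => tr n HK.[x] == iota c) (pts n))%N.
  rewrite size_allpairs_dep -size_filter -/P.
  elim: (P) => [|x s IHs] /=; first by rewrite muln0.
  by rewrite IHs mulnS; have [_ -> _] := as_spec HK.[x].
have memZ i : (i < size Z)%N -> [/\ iter n frob (nth (0, 0) Z i).1 = (nth (0, 0) Z i).1,
    tr n HK.[(nth (0, 0) Z i).1] = iota c
    & (nth (0, 0) Z i).2 ^+ q = (nth (0, 0) Z i).2 + HK.[(nth (0, 0) Z i).1]].
  move=> /(mem_nth (0, 0)) /allpairsPdep[x [y [Px Py ->]]] /=.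
  move: Px; rewrite mem_filter => /andP[/eqP-> Px].
  have [_ _ mem] := as_spec HK.[x]; move: Py; rewrite mem => /eqP->.
  by split=> //; apply/eqP; rewrite -mem_pts.
have UZ : uniq Z.
  apply: allpairs_uniq_dep; first by rewrite filter_uniq.
    by move=> x _; have [] := as_spec HK.[x].
  by move=> [? ?] [? ?] _ _ [-> ->].
have expRR z : z ^+ (q ^ m * q ^ m) = iter n frob z.
  by rewrite frob_iter -expnD addnn.
rewrite -szZ; apply: (@card_points_le K q d (size Z) HK
  (fun i => (nth (0, 0) Z i).1) (fun i => (nth (0, 0) Z i).2) _ _ _ _ _ _ (iota c)) => //.
- by rewrite size_map_poly.
- move=> i j eqx eqy; apply/val_inj/eqP; rewrite -(nth_uniq (0, 0) (ltn_ord i) (ltn_ord j) UZ).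
  by apply/eqP/injective_projections.
- by move=> i; have [] := memZ i (ltn_ord i).
- by move=> a b; apply: expfD_card.
- by move=> i; rewrite expRR; have [] := memZ i (ltn_ord i).
move=> i; rewrite expRR; have [_ <- yq] := memZ i (ltn_ord i).
exact: artin_schreier_iter.
Qed.

(** Upper bounds for the fibres suffice: as [psi] sums to zero, [q * Nc c] may be replaced by
    [q * Nc c - M]; these numbers are all nonpositive, with sum [- q * C * q ^ m]. *)
Lemma charsum_even_le m : ((q * d).*2.+1 < q ^ m)%N ->
  `|ext_charsum m.*2| <= ((3 * (q * d) + 2) * q ^ m)%:R.
Proof.
move=> q_large; set n := m.*2; set C := (3 * (q * d) + 2)%N.
have q_gt1 := finNzRing_gt1 F.
have n_gt0 : (0 < n)%N.
  by rewrite double_gt0 lt0n; apply: contraTneq q_large => ->; rewrite expn0; lia.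
have [Upts szpts mem_pts] := pts_spec iota n_gt0.
pose Nc c := count (fun x => tr n HK.[x] == iota c) (pts n).
pose M := (q ^ m * q ^ m + C * q ^ m)%N.
have leM c : (q * Nc c <= M)%N := fiber_card_le c q_large.
have trP x : x \in pts n -> exists a, tr n HK.[x] = iota a.
  rewrite mem_pts => /eqP fx; apply/(frob_fixedP iota)/eqP/tr_fixed.
  by rewrite iter_frob_horner fx.
have S_eq : ext_charsum n = \sum_c (Nc c)%:R * psi c.
  rewrite /ext_charsum.
  transitivity (\sum_(x <- pts n) \sum_(c | tr n HK.[x] == iota c) psi c).
    rewrite big_seq [RHS]big_seq; apply: eq_bigr => x /trP[a ->].
    rewrite /ext_char descendK (big_pred1 a) // => c /=.
    by rewrite (inj_eq (fmorph_inj iota)) eq_sym.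
  under eq_bigr do rewrite big_mkcond; rewrite exchange_big /=.
  apply: eq_bigr => c _; rewrite -big_mkcond /= big_const_seq iter_addr_0.
  by rewrite mulr_natl.
have sumN : (\sum_c Nc c = q ^ m * q ^ m)%N.
  rewrite -expnD addnn -/n -szpts -sum1_size.
  transitivity (\sum_(x <- pts n) \sum_(c | tr n HK.[x] == iota c) 1)%N.
    under [RHS]eq_bigr do rewrite big_mkcond; rewrite exchange_big /=.
    by apply: eq_bigr => c _; rewrite -big_mkcond /= sum1_count.
  rewrite big_seq [RHS]big_seq; apply: eq_bigr => x /trP[a ->].
  rewrite (big_pred1 a) // => c /=.
  by rewrite (inj_eq (fmorph_inj iota)) eq_sym.
have q0 : (0 : algC) < q%:R by rewrite ltr0n ltnW.
rewrite -(ler_pM2l q0) -[X in X * `|_|]gtr0_norm // -normrM.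
have -> : q%:R * ext_charsum n = \sum_c ((q * Nc c)%:R - M%:R) * psi c.
  under eq_bigr do rewrite mulrBl; rewrite sumrB -mulr_sumr sum_psi_eq0 mulr0 subr0.
  by rewrite S_eq mulr_sumr; apply: eq_bigr => c _; rewrite natrM mulrA.
apply: le_trans (ler_norm_sum _ _ _) _.
have -> : q%:R * (C * q ^ m)%:R = \sum_c (M%:R - (q * Nc c)%:R) :> algC.
  rewrite sumrB sumr_const -natr_sum -big_distrr /= sumN -mulrnA.
  have -> : (M * q = q * (q ^ m * q ^ m) + q * (C * q ^ m))%N by rewrite /M; ring.
  by rewrite -natrM natrD addrC addKr.
apply: ler_sum => c _; rewrite normrM psi_norm mulr1 distrC ger0_norm //.
by rewrite subr_ge0 ler_nat.
Qed.

End CharacterSums.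

(** * Newton's identities *)

Section Newton.
Variable R : comNzRingType.
Implicit Type s : seq R.

(** The [j]-th coefficient is the [j]-th elementary symmetric function of [s] up to the sign
    [(-1) ^ j]. *)
Definition recip_prod s : {poly R} := \prod_(t <- s) (1 - t *: 'X).
Definition psum k s : R := \sum_(t <- s) t ^+ k.

Lemma recip_prod_cons t s j : (recip_prod (t :: s))`_j =
  (recip_prod s)`_j - (if j is j'.+1 then t * (recip_prod s)`_j' else 0).
Proof.
rewrite /recip_prod big_cons mulrBl mul1r -scalerAl coefB coefZ coefXM.
by case: j => [|j] /=; rewrite ?mulr0.
Qed.

Lemma recip_prod0 s : (recip_prod s)`_0 = 1.
Proof.
elim: s => [|t s IHs]; first by rewrite /recip_prod big_nil coefC.
by rewrite recip_prod_cons IHs subr0.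
Qed.

Lemma size_recip_prod s : (size (recip_prod s) <= (size s).+1)%N.
Proof.
elim: s => [|t s IHs]; first by rewrite /recip_prod big_nil size_poly1.
apply/leq_sizeP => j lt_j; rewrite recip_prod_cons nth_default ?sub0r; last first.
  exact: leq_trans IHs (ltnW lt_j).
case: j lt_j => [|j] //=; rewrite ltnS => lt_j.
by rewrite nth_default ?mulr0 ?oppr0 // (leq_trans IHs).
Qed.

Lemma recip_prod_rev s j : (j <= size s)%N ->
  (recip_prod s)`_j = (\prod_(t <- s) ('X - t%:P))`_(size s - j).
Proof.
elim: s j => [|t s IHs] j /=.
  by rewrite leqn0 => /eqP->; rewrite /recip_prod !big_nil.
move=> le_j; rewrite recip_prod_cons big_cons mulrBl coefB coefXM coefCM.
case: j le_j => [|j] /=.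
  rewrite subn0 subr0 IHs // subn0 [X in _ - t * X]nth_default ?mulr0 ?subr0 //.
  by rewrite (size_prod_XsubC _ id).
rewrite ltnS => le_j; rewrite subSS (IHs j) // subn_eq0.
case: (ltngtP j (size s)) le_j => // [lt_j _|-> _].
  by rewrite IHs // subnS.
by rewrite nth_default ?size_recip_prod.
Qed.

Lemma newton_identity s k :
  \sum_(j < k.+1) (recip_prod s)`_j * psum (k.+1 - j) s
    + (k.+1)%:R * (recip_prod s)`_k.+1 = 0.
Proof.
elim: s k => [|t s IHs] k.
  rewrite big1 => [|j _]; first by rewrite /recip_prod big_nil coefC mulr0 addr0.
  by rewrite /psum big_nil mulr0.
set A := recip_prod s in IHs *.
have sumA m : \sum_(j < m) A`_j * psum (m - j) s = - (m%:R * A`_m).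
  case: m => [|m]; first by rewrite big_ord0 mul0r oppr0.
  by apply/eqP; rewrite -addr_eq0 IHs.
pose A' j := if j is j'.+1 then A`_j' else 0.
have coefA j : (recip_prod (t :: s))`_j = A`_j - t * A' j.
  by rewrite recip_prod_cons; case: j => //=; rewrite mulr0.
have sumA' : \sum_(j < k.+1) A' j * psum (k.+1 - j) s = - (k%:R * A`_k).
  by rewrite big_ord_recl mul0r add0r -sumA; apply: eq_bigr => j _; rewrite /= subSS.
(* Multiplying [A] by [1 - t X] and then by the geometric series of [t X] gives [A] back; this is
   the coefficient of degree [m]. *)
have telescope m : \sum_(j < m.+1) (A`_j - t * A' j) * t ^+ (m - j) = A`_m.
  elim: m => [|m IHm]; first by rewrite big_ord1 mulr0 subr0 mulr1.
  rewrite big_ord_recr /= subnn mulr1.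
  under eq_bigr => j _ do rewrite (subSn (ltn_ord j : (j <= m)%N)) exprS mulrCA.
  by rewrite -mulr_sumr IHm addrC subrK.
have -> : \sum_(j < k.+1) (recip_prod (t :: s))`_j * psum (k.+1 - j) (t :: s) =
    t * A`_k - (k.+1)%:R * A`_k.+1 + t * (k%:R * A`_k).
  rewrite -{1}(telescope k) -sumA mulr_sumr -[k%:R * _]opprK -sumA' mulrN mulr_sumr.
  rewrite -sumrN -!big_split /=; apply: eq_bigr => j _.
  rewrite coefA /psum big_cons -/(psum _ s) (subSn (ltn_ord j : (j <= k)%N)).
  rewrite exprS; ring.
by rewrite coefA /= -[in k.+1%:R]addn1 natrD; ring.
Qed.

(** In Newton's identity of order [k] the middle terms involve only earlier coefficients and power
    sums. Subtracting two instances leaves the [k]-th power sums and [k] times the [k]-th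
    coefficients. *)
Lemma newton_first_diff s s' d :
  (forall j, (j < d)%N -> (recip_prod s)`_j = (recip_prod s')`_j) ->
  (forall k, (0 < k < d)%N -> psum k s = psum k s') /\
  ((0 < d)%N -> psum d s' - psum d s =
      - (d%:R * ((recip_prod s')`_d - (recip_prod s)`_d))).
Proof.
move=> eqA.
have step k : (0 < k <= d)%N -> (forall i, (0 < i < k)%N -> psum i s = psum i s') ->
    psum k s' - psum k s = - (k%:R * ((recip_prod s')`_k - (recip_prod s)`_k)).
  case: k => // k /= le_k eqp.
  have := newton_identity s k; have := newton_identity s' k.
  rewrite !big_ord_recl !subn0 !recip_prod0 !mul1r.
  have -> : \sum_(i < k) (recip_prod s')`_(lift ord0 i) * psum (k.+1 - lift ord0 i) s' =
     \sum_(i < k) (recip_prod s)`_(lift ord0 i) * psum (k.+1 - lift ord0 i) s.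
    apply: eq_bigr => i _; rewrite eqA ?eqp //=; have := ltn_ord i; rewrite /bump /=; lia.
  by move=> /eqP; rewrite addr_eq0 => /eqP e1 /eqP; rewrite addr_eq0 => /eqP e2;
     rewrite mulrBr opprB -[X in _ = X - _]opprK -e2 -e1; ring.
have eqp k : (0 < k < d)%N -> psum k s = psum k s'.
  elim/ltn_ind: k => k IHk /andP[k_gt0 lt_k]; apply/esym/eqP; rewrite -subr_eq0.
  rewrite step ?k_gt0 ?(ltnW lt_k) ?eqA // ?subrr ?mulr0 ?oppr0 // => i /andP[i_gt0 lt_i].
  by rewrite IHk // i_gt0 (ltn_trans lt_i).
by split=> // d_gt0; apply: step; rewrite ?d_gt0 ?leqnn.
Qed.

End Newton.

(** The [ws] are the inverses of the roots of [L], which are nonzero; comparing constant terms fixes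
    the scalar factor. *)
Lemma recip_prod_factor (C : closedFieldType) (L : {poly C}) : L`_0 = 1 ->
  exists2 ws, (size ws).+1 = size L & L = recip_prod ws.
Proof.
move=> L0; have [r Lr] := closed_field_poly_normal L.
have nzL : L != 0 by apply: contra_eq_neq L0 => ->; rewrite coef0 eq_sym oner_eq0.
have nz_r : 0 \notin r.
  apply: contra_eqN L0 => r0; rewrite Lr coefZ -horner_coef0.
  have /eqP-> : root (\prod_(z <- r) ('X - z%:P)) 0 by rewrite root_prod_XsubC.
  by rewrite mulr0 eq_sym oner_eq0.
exists (map (@GRing.inv _) r).
  rewrite size_map Lr size_scale ?lead_coef_eq0 //.
  by rewrite (size_prod_XsubC _ id).
have prodE : recip_prod (map (@GRing.inv _) r) =
    (\prod_(z <- r) - z^-1) *: \prod_(z <- r) ('X - z%:P).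
  rewrite /recip_prod big_map -mul_polyC rmorph_prod -big_split /=.
  rewrite big_seq [RHS]big_seq; apply: eq_bigr => z r_z.
  have nz : z != 0 by apply: contraNneq nz_r => <-.
  by rewrite polyCN mulNr mulrBr -polyCM mulVf // polyC1 opprB mul_polyC.
have := recip_prod0 (map (@GRing.inv _) r); rewrite prodE coefZ.
have := L0; rewrite {1}Lr coefZ => e1 e2; rewrite Lr; congr (_ *: _).
have nzP : (\prod_(z <- r) ('X - z%:P))`_0 != 0.
  by apply: contra_eq_neq e2 => ->; rewrite mulr0 eq_sym oner_eq0.
by apply: (mulIf nzP); rewrite e1 e2.
Qed.

(** * The L-function *)

Lemma big_traject (R : Type) (idx : R) (op : Monoid.law idx) (T : Type) (f : T -> T)
    (x : T) n (G : T -> R) :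
  \big[op/idx]_(t <- traject f x n) G t = \big[op/idx]_(i < n) G (iter i f x).
Proof.
elim: n => [|n IHn]; first by rewrite big_nil big_ord0.
by rewrite trajectSr -cats1 big_cat big_seq1 IHn big_ord_recr.
Qed.

(** * Frobenius orbits and divisors of a polynomial *)

Section OrbitPolynomials.
Variables (F : finFieldType) (K : closedFieldType) (iota : {rmorphism F -> K}).
Local Notation q := #|F|.
Local Notation frob := (frob iota).
Local Notation pts := (@pts F K).
Implicit Types (g h : {poly K}) (x : K).

(** Iterates are kept with repetitions: for [x] in [pts j] this is the characteristic polynomial of
    [x] over [F], of degree exactly [j]. *)
Definition orbit_poly j x := \prod_(t <- traject frob x j) ('X - t%:P).

Lemma frob_inj : injective frob.
Proof. exact: fmorph_inj. Qed.

Lemma orbit_poly_monic j x : orbit_poly j x \is monic.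
Proof. exact: monic_prod_XsubC. Qed.

Lemma size_orbit_poly j x : size (orbit_poly j x) = j.+1.
Proof. by rewrite (size_prod_XsubC _ id) size_traject. Qed.

Lemma iter_frob_inj n : injective (iter n frob).
Proof. by elim: n => [|n IHn] x y //= /frob_inj/IHn. Qed.

Lemma frob_orbit_poly j x : iter j frob x = x ->
  map_poly frob (orbit_poly j x) = orbit_poly j x.
Proof.
move=> fx; rewrite /orbit_poly rmorph_prod /=.
under eq_bigr => t _ do rewrite map_polyXsubC.
rewrite !big_traject; case: j fx => [|j] fx; first by rewrite !big_ord0.
by rewrite big_ord_recr big_ord_recl /= -iterS fx mulrC.
Qed.

(** The iterates of [x] are all roots of [g], so they repeat, and injectivity of Frobenius turns a
    repetition into a return to [x]. Up to the first return they are distinct roots. *)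
Lemma orbit_period g x : g != 0 -> map_poly frob g = g -> root g x ->
  exists r, [/\ (0 < r)%N, iter r frob x = x, uniq (traject frob x r),
    orbit_poly r x %| g &
    forall j, (0 < j)%N -> iter j frob x = x -> (r <= j)%N].
Proof.
move=> g_nz fg gx; have root_iter j : root g (iter j frob x).
  elim: j => //= j IHj; rewrite /root -fg horner_map /=.
  by rewrite (eqP IHj) rmorph0.
have back i j : (i < j)%N -> iter i frob x = iter j frob x -> iter (j - i) frob x = x.
  move=> lt_ij eq_ij; apply: (@iter_frob_inj i).
  by rewrite -iterD subnKC // ltnW.
have r_ex : exists r, (0 < r)%N && (iter r frob x == x).
  have : ~~ uniq (traject frob x (size g)).
    apply/negP => Ut; suff : (size g < size g)%N by rewrite ltnn.
    rewrite -{1}(size_traject frob x (size g)); apply: max_poly_roots => //.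
    by apply/allP => t /trajectP[i _ ->].
  case/(uniqPn x) => i [j [lt_ij lt_j]]; rewrite size_traject in lt_j.
  rewrite !nth_traject ?(ltn_trans lt_ij) // => /back-/(_ lt_ij) eq_x.
  by exists (j - i)%N; rewrite subn_gt0 lt_ij eq_x eqxx.
have [r /andP[r_gt0 /eqP fr] min_r] := ex_minnP r_ex.
have Ur : uniq (traject frob x r).
  apply/negPn/negP => /(uniqPn x)[i [j [lt_ij lt_j]]]; rewrite size_traject in lt_j.
  rewrite !nth_traject ?(ltn_trans lt_ij) // => /back-/(_ lt_ij) eq_x.
  have := min_r (j - i)%N; rewrite subn_gt0 lt_ij eq_x eqxx => /(_ isT).
  by rewrite leqNgt (leq_ltn_trans (leq_subr _ _)).
exists r; split=> // [|j j_gt0 fj]; last by rewrite min_r // j_gt0 fj eqxx.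
apply: uniq_roots_dvdp; last by rewrite uniq_rootsE.
by apply/allP => t /trajectP[i _ ->].
Qed.

(* The orbit polynomials of [x] are the powers of its minimal polynomial over [F]. *)
Lemma sum_orbit_dvd g x B : g != 0 -> map_poly frob g = g -> (size g <= B.+1)%N ->
  (\sum_(1 <= j < B.+1) ((iter j frob x == x) && (orbit_poly j x %| g)%R) = mup x g)%N.
Proof.
move: {2}(size g) (leqnn (size g)) => n; elim: n g B => [|n IHn] g B le_n g_nz fg le_B.
  by rewrite leqn0 size_poly_eq0 (negPf g_nz) in le_n.
have [gx|gx] := boolP (root g x); last first.
  rewrite mupNroot // big_nat_cond big1 // => j /andP[/andP[j_gt0 _] _].
  case: (boolP (_ %| g)) => dv; rewrite ?andbF //; case/negP: gx.
  apply: (root_dvdp dv); rewrite root_prod_XsubC.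
  by case: j j_gt0 {dv} => // j _; rewrite mem_head.
have [r [r_gt0 fr Ur dvr min_r]] := orbit_period g_nz fg gx.
have Nr_nz := monic_neq0 (orbit_poly_monic r x).
(* As [r] is the exact period, this removes one copy of the minimal polynomial of [x]; the induction
   continues with [g']. *)
pose g' := g %/ orbit_poly r x.
have Dg : g = orbit_poly r x * g' by rewrite mulrC divpK.
have g'_nz : g' != 0 by apply: contraNneq g_nz => g'0; rewrite Dg g'0 mulr0.
have fg' : map_poly frob g' = g'.
  apply: (mulfI Nr_nz); rewrite -{1}(frob_orbit_poly fr) -rmorphM /= -Dg fg Dg.
  by rewrite -Dg.
have sz_g : size g = (r + size g')%N.
  by rewrite Dg size_monicM ?orbit_poly_monic // size_orbit_poly.
have g'_gt0 : (0 < size g')%N by rewrite size_poly_gt0.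
have dvdN j : (orbit_poly (r + j) x %| g) = (orbit_poly j x %| g').
  rewrite /orbit_poly trajectD big_cat /= fr -/(orbit_poly r x) -/(orbit_poly j x).
  by rewrite Dg dvdp_mul2l.
(* Indices below the period contribute nothing, the index [r] contributes one, and the later ones
   are those of [g'] shifted by [r]. *)
rewrite (@big_cat_nat _ _ _ r) //=; last by lia.
rewrite big_nat_cond big1 ?add0n; last first.
  move=> j /andP[/andP[j_gt0 lt_j] _]; case: eqP => //= /(min_r _ j_gt0).
  by rewrite leqNgt lt_j.
rewrite big_ltn; last by lia.
have := dvdN 0%N; rewrite addn0 /orbit_poly big_nil dvd1p => ->.
rewrite fr eqxx /= -[r.+1]add1n big_addn.
rewrite [in RHS]Dg mupM // mu_prod_XsubC count_uniq_mem //.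
have -> : x \in traject frob x r by case: (r) r_gt0 => // r' _; rewrite mem_head.
congr (_ + _)%N.
have -> : (B.+1 - r = (B - r).+1)%N by lia.
rewrite -(IHn g' (B - r)%N) //; first last.
- by move: le_B; rewrite sz_g; move: (size g') => s; lia.
- by move: le_n; rewrite sz_g; move: (size g') => s; lia.
apply: eq_bigr => j _; rewrite iterD fr addnC.
by rewrite -/(orbit_poly _ _) dvdN.
Qed.

(** After exchanging the sums, each root of [g] is counted with its multiplicity, so the total is
    the degree. *)
Lemma sum_count_orbit_dvd g B : g \is monic -> map_poly frob g = g ->
  (size g <= B.+1)%N ->
  (\sum_(1 <= j < B.+1) count (fun x => orbit_poly j x %| g)%R (pts j) = (size g).-1)%N.
Proof.
move=> g_mon fg le_B; have g_nz := monic_neq0 g_mon.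
have [s Ds] := closed_field_poly_normal g; rewrite (monicP g_mon) scale1r in Ds.
transitivity (\sum_(1 <= j < B.+1) \sum_(x <- undup s)
    ((iter j frob x == x) && (orbit_poly j x %| g)%R))%N.
  rewrite big_nat_cond [RHS]big_nat_cond; apply: eq_bigr => j /andP[/andP[j_gt0 _] _].
  have [Up _ mem_p] := pts_spec iota j_gt0.
  rewrite -sum1_count -big_filter -[RHS]big_mkcond -[RHS]big_filter /=.
  apply: perm_big; apply: uniq_perm; rewrite ?filter_uniq ?undup_uniq // => x.
  rewrite !mem_filter mem_p mem_undup andbC -andbA; case: eqP => //= _.
  case: (boolP (_ %| g)) => //= dv; apply/esym.
  rewrite -root_prod_XsubC -Ds; apply: (root_dvdp dv); rewrite root_prod_XsubC.
  by case: j j_gt0 {dv Up mem_p} => // j _; rewrite mem_head.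
rewrite exchange_big /=.
transitivity (\sum_(x <- undup s) count_mem x s)%N.
  by apply: eq_bigr => x _; rewrite (sum_orbit_dvd _ g_nz fg le_B) Ds mu_prod_XsubC.
have -> : (size g).-1 = (\sum_(x <- s) 1)%N.
  by rewrite sum1_size Ds (size_prod_XsubC _ id).
rewrite -[RHS]big_undup_iterop_count; apply: eq_bigr => x _.
by rewrite Monoid.iteropE iter_addn_0 mul1n.
Qed.

End OrbitPolynomials.

(** * Monic polynomials of given degree *)

Section MonicPolynomials.
Variable R : comNzRingType.

(** Indexing by the lower coefficients makes sums over monic polynomials of degree [n] range over a
    finite type. *)
Definition monic_of_rV n (a : 'rV[R]_n) : {poly R} := 'X^n + rVpoly a.

Lemma size_monic_of_rV n (a : 'rV[R]_n) : size (monic_of_rV a) = n.+1.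
Proof. by rewrite size_polyDl ?size_polyXn // ltnS size_poly. Qed.

Lemma monic_of_rV_monic n (a : 'rV[R]_n) : monic_of_rV a \is monic.
Proof. by rewrite monicE lead_coefDl ?lead_coefXn // size_polyXn ltnS size_poly. Qed.

Definition rV_of_monic n (g : {poly R}) : 'rV[R]_n := poly_rV (g - 'X^n).

Lemma monic_of_rVK n : cancel (@monic_of_rV n) (@rV_of_monic n).
Proof. by move=> a; rewrite /rV_of_monic /monic_of_rV addrC addKr rVpolyK. Qed.

Lemma rV_of_monicK n (g : {poly R}) : g \is monic -> size g = n.+1 ->
  monic_of_rV (rV_of_monic n g) = g.
Proof.
move=> g_mon sz_g; rewrite /monic_of_rV /rV_of_monic poly_rV_K; first by rewrite addrC subrK.
apply/leq_sizeP => j; rewrite leq_eqVlt coefB coefXn => /predU1P[<-|lt_j].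
  by move: g_mon; rewrite monicE lead_coefE sz_g /= => /eqP->; rewrite eqxx subrr.
by rewrite nth_default ?sz_g // gtn_eqF // subr0.
Qed.

Lemma monic_of_rVD n (a : 'rV[R]_n) (b : R) (i : 'I_n) :
  monic_of_rV (a + b *: delta_mx 0 i) = monic_of_rV a + b *: 'X^i.
Proof. by rewrite /monic_of_rV linearD linearZ /= rVpoly_delta addrA. Qed.

End MonicPolynomials.

(** * Coefficients of the L-function and character sums *)

Section LFunction.
Variables (F : finFieldType) (K : closedFieldType) (iota : {rmorphism F -> K}).
Local Notation q := #|F|.
Local Notation frob := (frob iota).
Local Notation pts := (@pts F K).
Variable psi : F -> algC.
Hypothesis psiD : forall a b, psi (a + b) = psi a * psi b.
Hypothesis psi_norm : forall a, `|psi a| = 1.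
Hypothesis psi_nontriv : exists a, psi a != 1.
Variables (H : {poly F}).
Local Notation HK := (map_poly iota H).
Local Notation tr := (tr iota).
Local Notation chi := (ext_char iota psi).
Local Notation charsum := (ext_charsum iota psi H).
Local Notation descend := (descend iota).
Local Notation orbit_poly := (orbit_poly iota).

Definition sum_horner (s : seq K) := \sum_(t <- s) HK.[t].

Definition roots_of (g : {poly F}) : seq K :=
  sval (closed_field_poly_normal (map_poly iota g)).

(** Multiplicative on monic polynomials, in analogy with a Dirichlet character; [Lcoef] gives the
    coefficients of its L-function. *)
Definition polychi g := chi (sum_horner (roots_of g)).

Lemma roots_ofE g : g \is monic ->
  map_poly iota g = \prod_(t <- roots_of g) ('X - t%:P).
Proof.
move=> g_mon; rewrite /roots_of; case: closed_field_poly_normal => r /= {1}->.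
by rewrite (monicP (monic_map iota g_mon)) scale1r.
Qed.

Lemma size_roots_of g : g \is monic -> size (roots_of g) = (size g).-1.
Proof.
by move=> g_mon; rewrite -(size_map_poly iota) roots_ofE // (size_prod_XsubC _ id).
Qed.

Lemma frob_map_iota g : map_poly frob (map_poly iota g) = map_poly iota g.
Proof.
by rewrite -map_poly_comp; apply: eq_map_poly => a /=; apply: frobK_iota.
Qed.

Lemma map_iota_surj (g : {poly K}) : map_poly frob g = g ->
  exists g0, g = map_poly iota g0.
Proof.
move=> fg; exists (\poly_(i < size g) descend g`_i); apply/polyP => i.
rewrite coef_map coef_poly; case: ltnP => [_|le_g]; last by rewrite nth_default //; apply/esym; exact: rmorph0.
have /frob_fixedP[a Da] : frob g`_i == g`_i by rewrite -{2}fg coef_map.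
by rewrite Da descendK.
Qed.

(** Invariance of the product means that Frobenius permutes [s], hence fixes the sum of [H] over
    [s]. *)
Lemma sum_horner_rational s : map_poly frob (\prod_(t <- s) ('X - t%:P)) =
  \prod_(t <- s) ('X - t%:P) -> exists a, sum_horner s = iota a.
Proof.
rewrite rmorph_prod /=; under eq_bigr => t _ do rewrite map_polyXsubC.
rewrite -(big_map frob xpredT (fun t => 'X - t%:P)) => /prod_XsubC_eq eq_s.
apply/(frob_fixedP iota); rewrite /sum_horner rmorph_sum /=; apply/eqP.
rewrite -[RHS](perm_big _ eq_s) big_map /=.
by apply: eq_bigr => t _; rewrite -frob_horner.
Qed.

Lemma chiD z t : (exists a, z = iota a) -> (exists a, t = iota a) ->
  chi (z + t) = chi z * chi t.
Proof.
by case=> a -> [b ->]; rewrite -rmorphD /ext_char !descendK psiD.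
Qed.

Lemma polychiM g h s : g \is monic -> h \is monic ->
  map_poly iota g = \prod_(t <- s) ('X - t%:P) ->
  polychi (g * h) = chi (sum_horner s) * polychi h.
Proof.
move=> g_mon h_mon Dg.
have ratH : exists a, sum_horner (roots_of h) = iota a.
  by apply: sum_horner_rational; rewrite -roots_ofE // frob_map_iota.
have ratG : exists a, sum_horner s = iota a.
  by apply: sum_horner_rational; rewrite -Dg frob_map_iota.
rewrite /polychi -chiD // /sum_horner -big_cat; congr chi.
apply: perm_big; apply: prod_XsubC_eq.
by rewrite -roots_ofE ?monicMl // rmorphM /= big_cat /= -Dg -roots_ofE.
Qed.

Definition Lcoef n := \sum_(a : 'rV[F]_n) polychi (monic_of_rV a).

Lemma tr_sum_horner j x : tr j HK.[x] = sum_horner (traject frob x j).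
Proof.
by rewrite /sum_horner big_traject; apply: eq_bigr => i _; rewrite iter_frob_horner.
Qed.

(** Multiplication by the orbit polynomial maps the monic polynomials of degree [m] bijectively onto
    its monic multiples of degree [j + m], and multiplies [polychi] by the character value at
    [x]. *)
Lemma orbit_twist j m x : iter j frob x = x ->
  chi (tr j HK.[x]) * Lcoef m =
  \sum_(a : 'rV[F]_(j + m) | orbit_poly j x %| map_poly iota (monic_of_rV a))
     polychi (monic_of_rV a).
Proof.
move=> fx; have [N DN] := map_iota_surj (frob_orbit_poly fx).
have N_mon : N \is monic by rewrite -(map_monic iota) -DN orbit_poly_monic.
have sz_N : size N = j.+1 by rewrite -(size_map_poly iota) -DN size_orbit_poly.
have sz_Ng g : g != 0 -> size (N * g : {poly F}) = (j + size g)%N.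
  by move=> nz; rewrite size_monicM // sz_N.
rewrite DN.
rewrite (reindex_onto (fun b : 'rV[F]_m => rV_of_monic (j + m) (N * monic_of_rV b))
  (fun a => rV_of_monic m (monic_of_rV a %/ N))) /=; last first.
  move=> a; rewrite dvdp_map => dvN.
  have Da : N * (monic_of_rV a %/ N) = monic_of_rV a by rewrite mulrC divpK.
  have Q_mon : monic_of_rV a %/ N \is monic.
    by rewrite -(monicMr _ N_mon) divpK ?monic_of_rV_monic.
  have sz_Q : size (monic_of_rV a %/ N) = m.+1.
    by apply: (@addnI j); rewrite -sz_Ng ?monic_neq0 // Da size_monic_of_rV addnS.
  by rewrite (rV_of_monicK Q_mon sz_Q) Da monic_of_rVK.
have eqM (b : 'rV[F]_m) : monic_of_rV (rV_of_monic (j + m) (N * monic_of_rV b)) =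
    N * monic_of_rV b.
  by rewrite rV_of_monicK ?monicMl ?monic_of_rV_monic // sz_Ng ?monic_neq0 ?monic_of_rV_monic // size_monic_of_rV addnS.
rewrite /Lcoef mulr_sumr; apply: eq_big => [b|b _].
  rewrite eqM dvdp_map dvdp_mulr //= mulKp ?monic_neq0 // monic_of_rVK eqxx //.
by rewrite eqM (polychiM (s := traject frob x j)) ?monic_of_rV_monic ?tr_sum_horner.
Qed.

(* By [sum_count_orbit_dvd], each monic polynomial of degree [n] has [n] orbit divisors. *)
Lemma charsum_recursion n :
  \sum_(j < n) charsum j.+1 * Lcoef (n - j.+1) = n%:R * Lcoef n.
Proof.
transitivity (\sum_(1 <= j < n.+1) \sum_(x <- pts j)
   \sum_(a : 'rV[F]_n | orbit_poly j x %| map_poly iota (monic_of_rV a))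
     polychi (monic_of_rV a)).
  rewrite big_add1 /= big_mkord; apply: eq_bigr => j _.
  rewrite /ext_charsum mulr_suml.
  have [_ _ mem_p] := pts_spec iota (ltn0Sn j).
  rewrite big_seq [RHS]big_seq; apply: eq_bigr => x; rewrite mem_p => /eqP fx.
  rewrite orbit_twist //.
  have -> // : (j.+1 + (n - j.+1) = n)%N by rewrite subnKC.
rewrite /Lcoef mulr_sumr.
under eq_bigr => j _ do under eq_bigr => x _ do rewrite big_mkcond.
under eq_bigr => j _ do rewrite exchange_big.
rewrite exchange_big /=; apply: eq_bigr => a _.
have sz_a : size (map_poly iota (monic_of_rV a)) = n.+1.
  by rewrite size_map_poly size_monic_of_rV.
have := @sum_count_orbit_dvd _ _ iota (map_poly iota (monic_of_rV a)) n.
rewrite sz_a monic_map ?monic_of_rV_monic // frob_map_iota leqnn.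
move=> /(_ isT erefl isT) /= cnt; rewrite -[X in X%:R * _]cnt natr_sum mulr_suml; apply: eq_bigr => j _.
by rewrite -big_mkcond /= big_const_seq iter_addr_0 mulr_natl.
Qed.

Lemma chi0 : chi 0 = 1.
Proof. by rewrite -(rmorph0 iota) /ext_char descendK psi0. Qed.

Lemma Lcoef0 : Lcoef 0 = 1.
Proof.
rewrite /Lcoef (big_pred1 0) => [|a]; last by rewrite /= thinmx0 eqxx.
have mon := monic_of_rV_monic (0 : 'rV[F]_0).
have := size_roots_of mon; rewrite size_monic_of_rV /= /polychi => /size0nil->.
by rewrite /sum_horner big_nil chi0.
Qed.

Variable d : nat.
Hypotheses (size_H : size H = d.+1) (d_gt0 : (0 < d)%N) (d_neq0 : d%:R != 0 :> F).

Lemma sum_hornerE s : sum_horner s = \sum_(k < d.+1) iota H`_k * psum k s.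
Proof.
rewrite /sum_horner; under eq_bigr => t _ do rewrite horner_coef size_map_poly size_H.
rewrite exchange_big /=; apply: eq_bigr => k _; rewrite mulr_sumr.
by apply: eq_bigr => t _; rewrite coef_map.
Qed.

(* The coefficient of ['X^(n - d)] enters the [d]-th power sum of the roots linearly, and
   no lower one, so translating it twists the whole sum by a nontrivial character. *)
Lemma Lcoef_eq0 n : (d <= n)%N -> Lcoef n = 0.
Proof.
move=> le_dn; have lt_n : (n - d < n)%N by lia.
have nz_c : d%:R * H`_d != 0.
  by rewrite mulf_neq0 // -[d]/(d.+1.-1) -size_H -lead_coefE lead_coef_eq0 -size_poly_gt0 size_H.
have [b0 ne1] := psi_nontriv.
(* Adding [b] to the coefficient changes the [d]-th power sum of the roots by [- d * b], hence the
   sum of [H] over the roots by exactly [b0]. *)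
pose b := - (b0 / (d%:R * H`_d)).
have shift (a : 'rV[F]_n) :
    polychi (monic_of_rV (a + b *: delta_mx 0 (Ordinal lt_n))) = psi b0 * polychi (monic_of_rV a).
  set g := monic_of_rV a; set g' := monic_of_rV _.
  have g_mon : g \is monic by apply: monic_of_rV_monic.
  have g'_mon : g' \is monic by apply: monic_of_rV_monic.
  have sz : size (roots_of g) = n by rewrite size_roots_of // size_monic_of_rV.
  have sz' : size (roots_of g') = n by rewrite size_roots_of // size_monic_of_rV.
  have coefA j : (j <= n)%N -> (recip_prod (roots_of g))`_j = iota g`_(n - j).
    by move=> le_j; rewrite recip_prod_rev sz // -roots_ofE // coef_map.
  have coefA' j : (j <= n)%N -> (recip_prod (roots_of g'))`_j =
       iota (g`_(n - j) + b * (n - j == n - d)%N%:R).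
    move=> le_j; rewrite recip_prod_rev sz' // -roots_ofE // coef_map.
    by rewrite /g' monic_of_rVD coefD coefZ coefXn.
  have [|eqp /(_ d_gt0) diffp] := @newton_first_diff _ (roots_of g) (roots_of g') d.
    move=> j lt_j; rewrite coefA ?coefA'; try lia.
    by rewrite (_ : (_ == _) = false) ?mulr0 ?addr0 //; lia.
  have ratG : exists a, sum_horner (roots_of g) = iota a.
    by apply: sum_horner_rational; rewrite -roots_ofE // frob_map_iota.
  have -> : psi b0 = chi (iota b0) by rewrite /ext_char descendK.
  rewrite /polychi -chiD //; last by exists b0.
  congr chi; apply/eqP; rewrite -subr_eq !sum_hornerE -sumrB big_ord_recr /=.
  rewrite big1 => [|k _]; last first.
    (* The power sum of order [0] is not covered by [eqp]; it counts the roots, [n] on both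
       sides. *)
    case: k => -[|k] lt_k /=; last by rewrite eqp ?subrr.
    rewrite /psum !big_const_seq !count_predT sz sz' subrr //.
  rewrite add0r -mulrBr diffp coefA // coefA' // eqxx mulr1 rmorphD addrC addKr.
  rewrite mulrN -(rmorph_nat iota) -!rmorphM -rmorphN /b; apply/eqP; congr (iota _).
  by rewrite !mulrN opprK mulrCA mulrA mulrC divfK.
have /eqP : Lcoef n = psi b0 * Lcoef n.
  rewrite {1}/Lcoef (reindex_inj (addIr (b *: delta_mx 0 (Ordinal lt_n)))) mulr_sumr.
  by apply: eq_bigr => a _; apply: shift.
rewrite -subr_eq0 -[X in X - _]mul1r -mulrBl mulf_eq0 subr_eq0 eq_sym (negPf ne1).
by move/eqP.
Qed.

(** The L-function is a polynomial of degree below [d] with constant term [1]. Newton's identity for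
    its reciprocal roots is, up to sign, the recursion of the character sums, so both agree by
    induction. *)
Lemma charsum_spectrum : exists2 ws : seq algC, (size ws < d)%N &
  forall n, (0 < n)%N -> charsum n = - psum n ws.
Proof.
pose L : {poly algC} := \poly_(i < d) Lcoef i.
have coefL i : L`_i = Lcoef i.
  by rewrite coef_poly; case: ltnP => // /Lcoef_eq0->.
have [|ws sz_ws DL] := @recip_prod_factor _ L; first by rewrite coefL Lcoef0.
exists ws; first by rewrite sz_ws size_poly.
case=> // n _; elim/ltn_ind: n => n IHn; apply/eqP; rewrite -addr_eq0.
have := newton_identity ws n; rewrite -DL coefL -charsum_recursion.
rewrite [X in _ + X](reindex_inj rev_ord_inj) -big_split big_ord_recl /= big1 => [|j _].
  by rewrite addr0 !coefL !subn0 subn1 subnn Lcoef0 mul1r mulr1 addrC => ->.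
rewrite /bump /= add1n; have lt_j := ltn_ord j.
have -> : (n.+1 - (n.+1 - j.+2).+1 = j.+1)%N by lia.
have -> : (n.+1 - j.+1 = (n.+1 - j.+2).+1)%N by lia.
by rewrite IHn ?coefL ?mulNr 1?mulrC ?subrr //; lia.
Qed.

End LFunction.

(** * The Weil bound *)

Lemma expr_unbounded (t D : algC) m0 : 1 < t -> (forall m, (m0 <= m)%N -> t ^+ m <= D) -> False.
Proof.
move=> t_gt1 bound.
have bernoulli m : 1 + m%:R * (t - 1) <= t ^+ m.
  elim: m => [|m IHm]; first by rewrite mul0r addr0 expr0.
  rewrite exprS; apply: le_trans (ler_wpM2l (ltW (lt_trans ltr01 t_gt1)) IHm).
  rewrite -subr_ge0 (_ : _ - _ = m%:R * (t - 1) ^+ 2); last by rewrite -natr1; ring.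
  by apply: mulr_ge0; rewrite ?ler0n // exprn_ge0 // subr_ge0 ltW.
have D_ge0 : 0 <= D.
  by apply: le_trans (bound m0 (leqnn _)); rewrite exprn_ge0 // ltW // (lt_trans ltr01).
have tN_gt0 : 0 < t - 1 by rewrite subr_gt0.
pose n := (m0 + Num.bound (D / (t - 1)))%N.
have le_n := le_trans (bernoulli n) (bound n (leq_addr _ _)).
have lt_n : D / (t - 1) < n%:R.
  apply: lt_le_trans (Num.Theory.archi_boundP _) _; first by rewrite divr_ge0 // ltW.
  by rewrite ler_nat leq_addl.
rewrite ltr_pdivrMr // in lt_n.
suff : D < D by rewrite ltxx.
by apply: lt_le_trans le_n; apply: lt_trans lt_n _; rewrite ltrDr ltr01.
Qed.

(* Interpolation at the distinct [v] isolates [v ^+ m] as a fixed combination of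
   consecutive power sums. *)
Lemma power_sum_bound (vs : seq algC) (C B : algC) m0 : 0 < B ->
  (forall m, (m0 <= m)%N -> `|psum m vs| <= C * B ^+ m) ->
  forall v, v \in vs -> `|v| <= B.
Proof.
move=> B_gt0 bound v v_vs.
pose P := \prod_(u <- undup vs | u != v) ('X - u%:P).
have Pv : P.[v] != 0.
  rewrite horner_prod prodf_seq_neq0; apply/allP => u _; apply/implyP => ne_uv.
  by rewrite hornerXsubC subr_eq0 eq_sym.
have P0 u : u \in vs -> u != v -> P.[u] = 0.
  move=> u_vs ne_uv; apply/eqP; rewrite horner_prod prodf_seq_eq0.
  by apply/hasP; exists u; rewrite ?mem_undup // ne_uv hornerXsubC subrr eqxx.
have key m : (m0 <= m)%N -> `|P.[v]| * `|v| ^+ m <= (\sum_(k < size P) `|P`_k| * C * B ^+ k) * B ^+ m.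
  move=> le_m.
  have sumE : \sum_(k < size P) P`_k * psum (k + m) vs = P.[v] * v ^+ m *+ count_mem v vs.
    under eq_bigr do rewrite mulr_sumr; rewrite exchange_big /=.
    transitivity (\sum_(u <- vs) P.[u] * u ^+ m).
      apply: eq_bigr => u _; rewrite horner_coef mulr_suml.
      by apply: eq_bigr => k _; rewrite exprD mulrA.
    rewrite (bigID (pred1 v)) /= [X in _ + X]big1_seq ?addr0 => [|u /andP[ne_uv u_vs]].
      rewrite -[RHS]iter_addr_0 -big_const_seq.
      by apply: eq_bigr => u /eqP->.
    by rewrite P0 ?mul0r.
  apply: (@le_trans _ _ `|P.[v] * v ^+ m *+ count_mem v vs|).
    rewrite normrMn normrM normrX -[X in X <= _]mulr1n ler_wpMn2l ?mulr_ge0 ?exprn_ge0 //.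
    by rewrite -has_count has_pred1.
  rewrite -sumE; apply: le_trans (ler_norm_sum _ _ _) _.
  rewrite mulr_suml; apply: ler_sum => k _; rewrite normrM -!mulrA ler_wpM2l //.
  by rewrite -exprD bound // (leq_trans le_m) ?leq_addl.
rewrite real_leNgt ?normr_real ?ger0_real ?ltW //; apply/negP => lt_Bv.
have nPv : 0 < `|P.[v]| by rewrite normr_gt0.
apply: (@expr_unbounded (`|v| / B) ((\sum_(k < size P) `|P`_k| * C * B ^+ k) / `|P.[v]|) m0).
  by rewrite ltr_pdivlMr // mul1r.
move=> m le_m; rewrite expr_div_n ler_pdivrMr ?exprn_gt0 // mulrAC ler_pdivlMr //.
by rewrite mulrC key.
Qed.

Section Weil.
Variables (F : finFieldType) (psi : F -> algC).
Local Notation q := #|F|.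
Hypothesis psiD : forall a b, psi (a + b) = psi a * psi b.
Hypothesis psi_norm : forall a, `|psi a| = 1.
Hypothesis psi_nontriv : exists a, psi a != 1.
Variables (H : {poly F}) (d : nat).
Hypotheses (size_H : size H = d.+1) (d_gt0 : (0 < d)%N) (d_neq0 : d%:R != 0 :> F).

Lemma coprime_card_degree : coprime q d.
Proof.
have [p [e [charFp _ ->]]] := finField_card_pow F.
by rewrite coprimeXl // prime_coprime ?(pcharf_prime charFp) // (dvdn_pcharf charFp).
Qed.

Theorem weil_additive : `|\sum_x psi H.[x]| <= d.-1%:R * sqrtC q%:R.
Proof.
have [K [iota _]] := countable_algebraic_closure F.
have [ws lt_ws Dws] := charsum_spectrum iota psiD psi_norm psi_nontriv size_H d_gt0 d_neq0.
have q_gt1 := finNzRing_gt1 F.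
have q_gt0 : 0 < q%:R :> algC by rewrite ltr0n ltnW.
have charsum1 : ext_charsum iota psi H 1 = \sum_x psi H.[x].
  have [Up _ mem_p] := pts_spec iota (ltn0Sn 0).
  have perm_p : perm_eq (pts F K 1) (map iota (enum F)).
    apply: uniq_perm => //; first by rewrite map_inj_uniq ?enum_uniq //; apply: fmorph_inj.
    move=> z; rewrite mem_p /=; apply/frob_fixedP/mapP => [[a ->]|[a _ ->]].
      by exists a; rewrite ?mem_enum.
    by exists a.
  rewrite /ext_charsum (perm_big _ perm_p) big_map big_enum; apply: eq_bigr => a _ /=.
  by rewrite /tr big_ord1 /= horner_map /ext_char descendK.
have ws_le w : w \in ws -> `|w| <= sqrtC q%:R.
  move=> ws_w.
  (* The sums of even order are power sums of the squares [w ^ 2]. The threshold on [m] ensures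
     [q ^ m > m], large enough for [charsum_even_le]. *)
  have : `|w ^+ 2| <= q%:R.
    apply: (@power_sum_bound (map (fun w => w ^+ 2) ws) (3 * (q * d) + 2)%:R _ (q * d).*2.+2) => //; last first.
      by apply/mapP; exists w.
    move=> m le_m.
    have -> : psum m (map (fun w => w ^+ 2) ws) = psum m.*2 ws.
      by rewrite /psum big_map; apply: eq_bigr => u _; rewrite -exprM mul2n.
    have large : ((q * d).*2.+1 < q ^ m)%N.
      exact: leq_trans (leq_trans le_m (ltnW (ltn_expl m q_gt1))) _.
    have := charsum_even_le iota psiD psi_norm psi_nontriv size_H d_gt0 coprime_card_degree large.
    rewrite Dws ?double_gt0 ?normrN; last exact: leq_trans le_m.
    by rewrite natrM natrX.
  rewrite normrX => le_w; rewrite -(@ler_pXn2r _ 2 isT) ?nnegrE ?sqrtC_ge0 ?(ltW q_gt0) //.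
  by rewrite sqrtCK.
rewrite -charsum1 Dws // normrN /psum; under eq_bigr do rewrite expr1.
apply: le_trans (ler_norm_sum _ _ _) _.
apply: (@le_trans _ _ (\sum_(w <- ws) sqrtC q%:R)).
  by rewrite big_seq [X in _ <= X]big_seq; apply: ler_sum => w /ws_le.
rewrite big_const_seq iter_addr_0 count_predT -[X in X <= _]mulr_natl ler_wpM2r ?sqrtC_ge0 ?(ltW q_gt0) //.
by rewrite ler_nat -ltnS prednK.
Qed.

End Weil.

(** * Spectrum of the graph *)

(** The abelian group [F] has as many irreducible characters as elements, hence a nontrivial one,
    and it is linear. *)
Lemma additive_char_exists (F : finFieldType) : exists psi : F -> algC,
  [/\ forall a b, psi (a + b) = psi a * psi b, forall a, `|psi a| = 1
    & exists a, psi a != 1].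
Proof.
pose G := [set: F]%G.
have abG : abelian G by apply: FinRing.zmod_abelian.
have lin (i : Iirr G) : 'chi_i \is a linear_char by apply/char_abelianP.
have Gx (x : F) : x \in G by rewrite inE.
have [i nz_i] : exists i : Iirr G, i != 0.
  have : (1 < #|{: Iirr G}|)%N.
    by rewrite card_Iirr_abelian // cardsT finNzRing_gt1.
  rewrite (cardD1 0) inE add1n ltnS => /card_gt0P[i]; rewrite !inE andbT => ne0.
  by exists i.
exists (fun x => 'chi_i x); split=> [a b|a|].
- exact: (lin_charM (lin i) (Gx a) (Gx b)).
- exact: (normC_lin_char (lin i) (Gx a)).
apply/existsP; apply: contraNT nz_i => /existsPn eq1.
rewrite -irr_eq1; apply/eqP/cfunP => x; rewrite cfun1E Gx /=.
by apply/eqP/negPn/eq1.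
Qed.

(** * Eigenvalues of Cayley graphs on a vector space *)

Section CayleyGraph.
Variables (F : finFieldType) (psi : F -> algC) (k : nat).
Local Notation q := #|F|.
Local Notation V := 'rV[F]_k.
Hypothesis psiD : forall a b, psi (a + b) = psi a * psi b.
Hypothesis psi_norm : forall a, `|psi a| = 1.
Hypothesis psi_nontriv : exists a, psi a != 1.

Definition dot (w u : V) : F := (w *m u^T) 0 0.

Lemma dotDr w u v : dot w (u + v) = dot w u + dot w v.
Proof. by rewrite /dot linearD mulmxDr mxE. Qed.

Lemma dotDl w v u : dot (w + v) u = dot w u + dot v u.
Proof. by rewrite /dot mulmxDl mxE. Qed.

Lemma psiN a : psi (- a) = (psi a)^-1.
Proof.
apply: (mulfI (psi_neq0 psi_norm a)); rewrite -psiD subrr (psi0 psiD psi_norm).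
by rewrite divff ?(psi_neq0 psi_norm).
Qed.

Lemma sum_psi_dot u : \sum_w psi (dot w u) = if u == 0 then (#|{: V}|)%:R else 0.
Proof.
case: eqP => [->|/eqP/rV0Pn[i nz_u]].
  rewrite -sum1_card natr_sum; apply: eq_bigr => w _.
  by rewrite /dot trmx0 mulmx0 mxE (psi0 psiD psi_norm).
have [b ne1] := psi_nontriv; pose v : V := (b / u 0 i) *: delta_mx 0 i.
have dv : dot v u = b.
  rewrite /dot -scalemxAl mxE -rowE !mxE divfK //.
have /eqP : psi b * \sum_w psi (dot w u) = \sum_w psi (dot w u).
  rewrite mulr_sumr [RHS](reindex_inj (addrI v)).
  by apply: eq_bigr => w _; rewrite dotDl psiD dv.
rewrite -subr_eq0 -[X in _ - X]mul1r -mulrBl mulf_eq0 subr_eq0 (negPf ne1).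
by move/eqP.
Qed.

Variable conn : pred V.

Definition cayley_mx : 'M[algC]_#|{: V}| :=
  \matrix_(i, j) (conn (enum_val j - enum_val i) : nat)%:R.

Definition cayley_eig w := \sum_(s | conn s) psi (dot w s).

Lemma sum_enum_val (f : V -> algC) : \sum_(i < #|{: V}|) f (enum_val i) = \sum_u f u.
Proof.
rewrite (reindex enum_rank) /=; last exact/onW_bij/enum_rank_bij.
by apply: eq_bigr => u _; rewrite enum_rankK.
Qed.

Lemma cayley_eigP w : eigenvalue cayley_mx (cayley_eig w).
Proof.
(* Eigenvectors are rows multiplied from the left, which puts the minus sign into the character. *)
apply/eigenvalueP; exists (\row_i psi (dot w (- enum_val i))); last first.
  apply/rV0Pn; exists (enum_rank 0).
  by rewrite mxE enum_rankK (psi_neq0 psi_norm).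
apply/rowP=> j; rewrite !mxE; under eq_bigr do rewrite !mxE.
rewrite (sum_enum_val (fun u => psi (dot w (- u)) * (conn (enum_val j - u) : nat)%:R)).
rewrite (reindex_inj (inj_comp (addrI (enum_val j)) oppr_inj)) /=.
rewrite /cayley_eig mulr_suml [RHS]big_mkcond; apply: eq_bigr => s _.
rewrite opprD opprK addrA subrr add0r; case: (conn s); rewrite ?mulr0 // mulr1.
by rewrite addrC dotDr psiD.
Qed.

(** If [a] were none of these values, the eigenvector equation would kill every Fourier coefficient
    [hat w], and Fourier inversion the eigenvector itself. *)
Lemma eigenvalue_cayley a : eigenvalue cayley_mx a -> exists w, a = cayley_eig w.
Proof.
case/eigenvalueP => v va nz_v.
have [/existsP[w /eqP]|/existsPn no] := boolP [exists w, a == cayley_eig w].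
  by exists w.
pose hat w := \sum_i v 0 i * psi (dot w (enum_val i)).
have hat0 w : hat w = 0.
  have : a * hat w = cayley_eig w * hat w.
    rewrite {1}/hat mulr_sumr.
    transitivity (\sum_j (v *m cayley_mx) 0 j * psi (dot w (enum_val j))).
      by apply: eq_bigr => j _; rewrite va mxE mulrA.
    under eq_bigr do rewrite mxE mulr_suml; rewrite exchange_big /=.
    rewrite /hat mulr_sumr; apply: eq_bigr => i _.
    under eq_bigr do rewrite mxE -mulrA; rewrite -mulr_sumr mulrCA; congr (_ * _).
    rewrite (sum_enum_val (fun u => (conn (u - enum_val i) : nat)%:R * psi (dot w u))).
    rewrite (reindex_inj (addrI (enum_val i))) /= /cayley_eig mulr_suml [RHS]big_mkcond.
    apply: eq_bigr => s _; rewrite addrAC subrr add0r dotDr psiD.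
    by case: (conn s); rewrite ?mul0r // mul1r mulrC.
  move/eqP; rewrite -subr_eq0 -mulrBl mulf_eq0 subr_eq0 (negPf (no w)).
  by move/eqP.
case/negP: nz_v; apply/eqP/rowP => i0; rewrite mxE.
have : \sum_w hat w * psi (dot w (- enum_val i0)) = 0.
  by rewrite big1 // => w _; rewrite hat0 mul0r.
under eq_bigr do rewrite mulr_suml; rewrite exchange_big /=.
under eq_bigr => i _.
  under eq_bigr do rewrite -mulrA -psiD -dotDr.
  rewrite -mulr_sumr sum_psi_dot subr_eq0 (inj_eq enum_val_inj).
  over.
rewrite (bigD1 i0) //= eqxx big1 ?addr0 => [/eqP|i /negPf->]; last by rewrite mulr0.
rewrite mulf_eq0 pnatr_eq0 => /orP[/eqP//|].
by rewrite -leqn0 leqNgt => /negP[]; apply/card_gt0P; exists 0.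
Qed.

End CayleyGraph.

(** * The connection set of the graph and its exponential sums *)

Section SGraph.
Variables (F : finFieldType) (k' : nat).
Local Notation k := k'.+2.
Local Notation q := #|F|.
Local Notation V := 'rV[F]_k.
Variables (f g : 'I_k -> {poly F}) (p : nat).
Hypothesis charFp : p \in [pchar F].
Hypothesis g_odd : forall i : 'I_k, (2 <= i)%N -> g i \Po (- 'X) = - g i.
Hypothesis g_0 : forall i : 'I_k, (2 <= i)%N -> (g i).[0] = 0.
Hypothesis f_deg : (1 <= maxdeg f)%N.
Hypothesis g_deg : (1 <= maxdeg g)%N.
Hypothesis g_deg_lt : (maxdeg g < p)%N.
Variable psi : F -> algC.
Hypothesis psiD : forall a b, psi (a + b) = psi a * psi b.
Hypothesis psi_norm : forall a, `|psi a| = 1.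
Hypothesis psi_nontriv : exists a, psi a != 1.

Definition S_conn (s : V) := Sadj f g 0 s.

(** Parametrizes the connection set by the first coordinate [x], nonzero, and the quotient [t] of
    the second by the first. *)
Definition S_elt (xt : F * F) : V :=
  \row_i (if i == 0 then xt.1 else if i == 1 then xt.1 * xt.2
          else (g i).[xt.1] * (f i).[xt.2]).

(** The polynomial [H_t]: the pairing of [w] with [S_elt (x, t)] as a polynomial in [x]. *)
Definition S_poly (w : V) (t : F) : {poly F} :=
  (w 0 0 + w 0 1 * t) *: 'X + \sum_(i : 'I_k | (2 <= i)%N) (w 0 i * (f i).[t]) *: g i.

Lemma Smx_cayley : Smx f g = cayley_mx S_conn.
Proof.
apply/matrixP => i j; rewrite !mxE /S_conn /Sadj !mxE !subr0.
congr (nat_of_bool (_ && _))%:R; apply: eq_forallb => l.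
by rewrite !mxE subr0.
Qed.

Lemma ord_cases (i : 'I_k) : [\/ i = 0, i = 1 | (2 <= i)%N /\ (i != 0) && (i != 1)].
Proof.
case: i => -[|[|i]] lt_i; first by constructor 1; apply: val_inj.
  by constructor 2; apply: val_inj.
by constructor 3; split=> //; apply/andP; split; apply/eqP => /(congr1 val).
Qed.

Lemma sum_ord_k (G : 'I_k -> F) :
  \sum_i G i = G 0 + G 1 + \sum_(i : 'I_k | (2 <= i)%N) G i.
Proof.
rewrite (bigD1 0) //= (bigD1 1) //= addrA; congr (_ + _); apply: eq_bigl => i.
by case: (ord_cases i) => [->|->|[-> ->]].
Qed.

Lemma dot_S_elt w xt : dot w (S_elt xt) = (S_poly w xt.2).[xt.1].
Proof.
rewrite /dot mxE sum_ord_k /S_poly hornerD hornerZ hornerX horner_sum.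
rewrite !mxE /= mulrDl; congr (_ + _ + _); first by rewrite mulrCA mulrC -!mulrA mulrC.
apply: eq_bigr => i; rewrite hornerZ !mxE.
by case: (ord_cases i) => [->|->|[_ /andP[/negPf-> /negPf->]]] // _; ring.
Qed.

Lemma S_eigE w : cayley_eig psi S_conn w =
  \sum_t \sum_(x | x != 0) psi (S_poly w t).[x].
Proof.
rewrite exchange_big pair_big /= /cayley_eig.
rewrite (reindex_onto S_elt (fun s => (s 0 0, s 0 1 / s 0 0))) /=; last first.
  move=> s; rewrite /S_conn /Sadj !mxE !subr0 => /andP[nz_s /forallP sE].
  apply/rowP => i; rewrite !mxE /=; case: (ord_cases i) => [->//|->|[le_i /andP[/negPf-> /negPf->]]].
    by rewrite /= mulrC divfK.
  by have := sE i; rewrite le_i !mxE subr0 => /eqP.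
apply: eq_big => [[x t]|xt _]; last by rewrite dot_S_elt.
rewrite /S_conn /Sadj !mxE /= !subr0 andbT; case: eqP => //= /eqP nz_x.
rewrite xpair_eqE eqxx [x * t]mulrC mulfK // eqxx /= andbT.
apply/forallP => i; apply/implyP => le_i; rewrite !mxE subr0 /=.
by case: (ord_cases i) le_i => [->|->|[_ /andP[/negPf-> /negPf->]]].
Qed.

Lemma S_poly0 w t : (S_poly w t).[0] = 0.
Proof.
rewrite /S_poly hornerD hornerZ hornerX mulr0 add0r horner_sum big1 // => i le_i.
by rewrite hornerZ g_0 // mulr0.
Qed.

Lemma S_polyN w t x : (S_poly w t).[- x] = - (S_poly w t).[x].
Proof.
rewrite /S_poly !hornerD !hornerZ !hornerX !horner_sum opprD mulrN -sumrN; congr (_ + _).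
apply: eq_bigr => i le_i; rewrite !hornerZ -mulrN; congr (_ * _).
by rewrite -hornerN -g_odd // horner_comp !hornerE.
Qed.

(** Conjugation inverts the values of [psi]; as [H_t] is odd, this amounts to replacing [x] by
    [- x]. *)
Lemma S_eig_real w : cayley_eig psi S_conn w \is Num.real.
Proof.
rewrite S_eigE; apply/CrealP; rewrite rmorph_sum; apply: eq_bigr => t _.
rewrite rmorph_sum /= [RHS](reindex_inj oppr_inj) /=.
apply: eq_big => [x|x _]; first by rewrite oppr_eq0.
rewrite S_polyN (psiN psiD psi_norm) invC_norm psi_norm expr1n invr1 mul1r //.
Qed.

Lemma size_le_maxdeg (h : 'I_k -> {poly F}) (i : 'I_k) :
  (2 <= i)%N -> (size (h i) <= (maxdeg h).+1)%N.
Proof.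
move=> le_i; apply: (leq_trans (leqSpred _)); rewrite ltnS.
exact: (@leq_bigmax_cond _ _ (fun i => (size (h i)).-1)).
Qed.

Lemma size_S_poly w t : (size (S_poly w t) <= (maxdeg g).+1)%N.
Proof.
rewrite (leq_trans (size_polyD _ _)) // geq_max; apply/andP; split.
  by rewrite (leq_trans (size_scale_leq _ _)) // size_polyX ltnS.
apply: (leq_trans (size_sum _ _ _)); apply/bigmax_leqP => i le_i.
by rewrite (leq_trans (size_scale_leq _ _)) // size_le_maxdeg.
Qed.

(** Each coefficient of [H_t] is a polynomial in [t] of degree at most [maxdeg f], where [f_deg]
    accommodates the linear term. One of them is nonzero, and it vanishes whenever [H_t] does. *)
Lemma S_poly_roots w t0 : S_poly w t0 != 0 ->
  (#|[set t | (S_poly w t == 0)%R]| <= maxdeg f)%N.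
Proof.
move=> nz.
pose c j : {poly F} := (j == 1%N)%:R *: ((w 0 0)%:P + w 0 1 *: 'X)
   + \sum_(i : 'I_k | (2 <= i)%N) (w 0 i * (g i)`_j) *: f i.
have cE j t : (S_poly w t)`_j = (c j).[t].
  rewrite /S_poly /c coefD coefZ coefX coef_sum !hornerE horner_sum.
  congr (_ + _); first by rewrite mulrC.
  by apply: eq_bigr => i _; rewrite coefZ hornerZ mulrAC.
have [j nz_j] : exists j, c j != 0.
  exists (size (S_poly w t0)).-1.
  apply: contraNneq nz => c0; rewrite -lead_coef_eq0 lead_coefE cE c0 horner0 //.
have sz_c : (size (c j) <= (maxdeg f).+1)%N.
  rewrite (leq_trans (size_polyD _ _)) // geq_max; apply/andP; split.
    rewrite (leq_trans (size_scale_leq _ _)) // (leq_trans (size_polyD _ _)) // geq_max.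
    rewrite (leq_trans (size_polyC_leq1 _)) //=.
    by rewrite (leq_trans (size_scale_leq _ _)) // size_polyX ltnS.
  apply: (leq_trans (size_sum _ _ _)); apply/bigmax_leqP => i le_i.
  by rewrite (leq_trans (size_scale_leq _ _)) // size_le_maxdeg.
rewrite -ltnS; apply: leq_trans sz_c; rewrite cardE; apply: max_poly_roots => //.
  apply/allP => t; rewrite mem_enum inE => /eqP t0'.
  by rewrite /root -cE t0' coef0.
exact: enum_uniq.
Qed.

Lemma S_eig_bound w : cayley_eig psi S_conn w != (q * (q - 1))%:R ->
  `|cayley_eig psi S_conn w| <=
     (maxdeg f)%:R * q%:R + q%:R * ((maxdeg g)%:R * sqrtC q%:R).
Proof.
rewrite S_eigE => ne_d.
have q_gt1 := finNzRing_gt1 F.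
have q_gt0 : 0 < q%:R :> algC by rewrite ltr0n ltnW.
have sqrt_ge1 : 1 <= sqrtC q%:R :> algC.
  rewrite -(@ler_pXn2r _ 2 isT) ?nnegrE ?ler01 ?sqrtC_ge0 ?(ltW q_gt0) //.
  by rewrite expr1n sqrtCK ler1n ltnW.
have card_nz : \sum_(x : F | x != 0) 1 = (q - 1)%:R :> algC.
  by rewrite sumr_const cardC1 subn1.
have [t0 nz_t0] : exists t, S_poly w t != 0.
  apply/existsP; apply: contraNT ne_d => /existsPn all0; apply/eqP.
  transitivity (\sum_(t : F) (q - 1)%:R : algC).
    apply: eq_bigr => t _; rewrite -card_nz; apply: eq_bigr => x _.
    by rewrite (eqP (negPn (all0 t))) horner0 (psi0 psiD psi_norm).
  by rewrite sumr_const natrM mulr_natl.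
have inner t : `|\sum_(x | x != 0) psi (S_poly w t).[x]| <=
    (if S_poly w t == 0 then q%:R else 0) + (maxdeg g)%:R * sqrtC q%:R.
  case: eqP => [->|/eqP nz].
    apply: (@le_trans _ _ q%:R); last first.
      by rewrite lerDl mulr_ge0 ?ler0n ?sqrtC_ge0 ?(ltW q_gt0).
    apply: le_trans (ler_norm_sum _ _ _) _; under eq_bigr do rewrite psi_norm.
    by rewrite card_nz ler_nat leq_subr.
  pose d := (size (S_poly w t)).-1.
  have sz : size (S_poly w t) = d.+1 by rewrite prednK // size_poly_gt0.
  (* A constant [H_t] would be zero, because [H_t] vanishes at [0]. *)
  have d_gt0 : (0 < d)%N.
    rewrite lt0n; apply: contraNneq nz => d0.
    have Dc := size1_polyC (eq_leq (etrans sz (congr1 S d0))).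
    by have := S_poly0 w t; rewrite {1}Dc hornerC => c0; rewrite Dc c0.
  have le_d : (d <= maxdeg g)%N by rewrite -ltnS -sz size_S_poly.
  have d_neq0 : d%:R != 0 :> F.
    by rewrite -(dvdn_pcharf charFp) gtnNdvd // (leq_ltn_trans le_d).
  have := weil_additive psiD psi_norm psi_nontriv sz d_gt0 d_neq0.
  rewrite (bigD1 0) //= S_poly0 (psi0 psiD psi_norm) add0r => weil.
  (* Leaving out the term [1] at [x = 0] costs at most [sqrtC q], which turns Weil's factor [d - 1]
     into [d]. *)
  rewrite -[\sum_(x | _) _](addKr 1); apply: le_trans (ler_normD _ _) _.
  rewrite normrN1; apply: (@le_trans _ _ (sqrtC q%:R + d.-1%:R * sqrtC q%:R)).
    exact: lerD.
  rewrite -{1}[sqrtC _]mul1r -mulrDl nat1r prednK //.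
  by rewrite ler_wpM2r ?sqrtC_ge0 ?(ltW q_gt0) // ler_nat.
apply: le_trans (ler_norm_sum _ _ _) _.
apply: le_trans (ler_sum _ (fun t _ => inner t)) _.
rewrite big_split /= sumr_const [X in _ + X](_ : _ = q%:R * ((maxdeg g)%:R * sqrtC q%:R)).
  rewrite lerD2r -big_mkcond /= sumr_const -[X in X <= _]mulr_natl ler_wpM2r ?ler0n //.
  rewrite ler_nat (leq_trans _ (S_poly_roots nz_t0)) //.
  by apply/eq_leq/eq_card => t; rewrite !inE.
by rewrite [RHS]mulr_natl.
Qed.

(** Here every [H_t] is ['X]. The value shows that an eigenvalue other than the degree exists, so
    that a largest such one can be taken. *)
Lemma S_eig_nontrivial : cayley_eig psi S_conn (delta_mx 0 0) = - q%:R.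
Proof.
rewrite S_eigE.
have polyE t : S_poly (delta_mx 0 0) t = 'X.
  rewrite /S_poly !mxE /= mul0r addr0 scale1r big1 ?addr0 // => i.
  rewrite mxE /=; case: (ord_cases i) => [->|->|[_ /andP[/negPf-> _]]] // _.
  by rewrite mul0r scale0r.
transitivity (\sum_(t : F) (-1 : algC)); last first.
  by rewrite sumr_const mulNrn.
apply: eq_bigr => t _; under eq_bigr do rewrite polyE hornerX.
have := sum_psi_eq0 psiD psi_nontriv.
by rewrite (bigD1 0) //= (psi0 psiD psi_norm) => /eqP; rewrite addrC addr_eq0 => /eqP.
Qed.

Lemma Smx_spectrum :
  [/\ exists2 a, eigenvalue (Smx f g) a & a != (q * (q - 1))%:R,
      forall a, eigenvalue (Smx f g) a -> a \is Num.real
    & forall a, eigenvalue (Smx f g) a -> a != (q * (q - 1))%:R ->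
        `|a| <= (maxdeg f)%:R * q%:R + q%:R * ((maxdeg g)%:R * sqrtC q%:R)].
Proof.
have q_gt1 := finNzRing_gt1 F.
rewrite Smx_cayley; split.
- exists (cayley_eig psi S_conn (delta_mx 0 0)).
    exact: cayley_eigP.
  rewrite S_eig_nontrivial eq_sym -addr_eq0 -natrD pnatr_eq0 -lt0n.
  by rewrite addn_gt0 (ltnW q_gt1) orbT.
- move=> a /(eigenvalue_cayley psiD psi_norm psi_nontriv)[w ->].
  exact: S_eig_real.
move=> a /(eigenvalue_cayley psiD psi_norm psi_nontriv)[w ->].
exact: S_eig_bound.
Qed.

End SGraph.

(** * The largest remaining eigenvalue and its growth *)

(** The order on [algC] is partial, so the fold is sure to be a maximum only on lists of reals;
    starting from the head keeps the result in a nonempty list. *)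
Definition max_algC (s : seq algC) := foldr (fun x y => if x <= y then y else x) (head 0 s) s.

Lemma max_algCP (s : seq algC) : s != [::] -> {in s, forall x, x \is Num.real} ->
  max_algC s \in s /\ {in s, forall x, x <= max_algC s}.
Proof.
rewrite /max_algC; case: s => // x0 s _ /= real_s.
have step t : {subset t <= x0 :: s} ->
    let m := foldr (fun x y => if x <= y then y else x) x0 t in
    m \in x0 :: s /\ {in t, forall x, x <= m}.
  elim: t => [|x t IHt] sub /=; first by rewrite mem_head.
  have [|m_s max_m] := IHt; first by move=> y t_y; rewrite sub // inE t_y orbT.
  set m := foldr _ _ _ in m_s max_m *.
  have x_s : x \in x0 :: s by rewrite sub ?mem_head.
  case: ifP => le_xm.
    by split=> // y; rewrite inE => /predU1P[->|/max_m].
  have lt_mx : m < x by rewrite real_ltNge ?real_s // le_xm.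
  split=> // y; rewrite inE => /predU1P[->//|/max_m le_ym].
  exact: le_trans le_ym (ltW lt_mx).
exact: (step (x0 :: s)).
Qed.

Definition second_eig n (A : 'M[algC]_n) (d : algC) : algC :=
  max_algC [seq a <- sval (closed_field_poly_normal (char_poly A)) | a != d].

Lemma second_eigP n (A : 'M[algC]_n) (d : algC) :
  (exists2 a, eigenvalue A a & a != d) ->
  (forall a, eigenvalue A a -> a \is Num.real) ->
  largest_eig_except A d (second_eig A d).
Proof.
move=> [a0 ev_a0 ne_a0] real_ev; rewrite /second_eig.
case: closed_field_poly_normal => r /= Dr.
rewrite (monicP (char_poly_monic A)) scale1r in Dr.
have mem_r a : (a \in [seq a <- r | a != d]) = (a != d) && eigenvalue A a.
  by rewrite mem_filter eigenvalue_root_char Dr root_prod_XsubC.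
have [||in_r max_r] := @max_algCP [seq a <- r | a != d].
- have : a0 \in [seq a <- r | a != d] by rewrite mem_r ne_a0.
  by case: filter.
- by move=> a; rewrite mem_r => /andP[_ /real_ev].
move: in_r; rewrite mem_r => /andP[ne_d ev]; split=> // a ev_a ne_a.
by rewrite max_r // mem_r ne_a.
Qed.

Theorem mainTheorem8
  (k : nat) (hk : (3 <= k)%N)
  (F : nat -> finFieldType)
  (p : nat -> nat)
  (f g : forall m : nat, 'I_k -> {poly F m})
  (hp : forall m, p m \in [pchar (F m)])
  (hinc : forall m, (#|F m| < #|F m.+1|)%N)
  (hfdeg : forall m (i : 'I_k), (2 <= (i : nat))%N -> (size (f m i) <= #|F m|)%N)
  (hgdeg : forall m (i : 'I_k), (2 <= (i : nat))%N -> (size (g m i) <= #|F m|)%N)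
  (hgodd : forall m (i : 'I_k), (2 <= (i : nat))%N ->
      g m i \Po (- 'X) = - g m i)
  (hg0 : forall m (i : 'I_k), (2 <= (i : nat))%N -> (g m i).[0] = 0)
  (hdf1 : forall m, (1 <= maxdeg (f m))%N)
  (hdf : forall eps : algC, 0 < eps -> exists M : nat, forall m, (M <= m)%N ->
      (maxdeg (f m))%:R / (#|F m|)%:R < eps)
  (hdg : forall eps : algC, 0 < eps -> exists M : nat, forall m, (M <= m)%N ->
      (maxdeg (g m))%:R / sqrtC (#|F m|)%:R < eps)
  (hdg1 : forall m, (1 <= maxdeg (g m))%N)
  (hdgp : forall m, (maxdeg (g m) < p m)%N) :
  exists lam : nat -> algC,
    (forall m, largest_eig_except (Smx (f m) (g m))
                 ((#|F m| * (#|F m| - 1))%N)%:R (lam m)) /\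
    (forall eps : algC, 0 < eps -> exists M : nat, forall m, (M <= m)%N ->
        `|lam m| / ((#|F m|)%:R ^+ 2) < eps).
Proof.
case: k hk f g hp hfdeg hgdeg hgodd hg0 hdf1 hdf hdg hdg1 hdgp => [|[|k]] // _ f g
  hp _ _ hgodd hg0 hdf1 hdf hdg hdg1 hdgp.
pose d m : algC := (#|F m| * (#|F m| - 1))%:R.
have spec m : [/\ exists2 a, eigenvalue (Smx (f m) (g m)) a & a != d m,
      forall a, eigenvalue (Smx (f m) (g m)) a -> a \is Num.real
    & forall a, eigenvalue (Smx (f m) (g m)) a -> a != d m ->
        `|a| <= (maxdeg (f m))%:R * #|F m|%:R +
                #|F m|%:R * ((maxdeg (g m))%:R * sqrtC #|F m|%:R)].
  have [psi [psiD psi_norm psi_nontriv]] := additive_char_exists (F m).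
  exact: (Smx_spectrum (hp m) (hgodd m) (hg0 m) (hdf1 m) (hdg1 m) (hdgp m)
            psiD psi_norm psi_nontriv).
have lamP m : largest_eig_except (Smx (f m) (g m)) (d m) (second_eig (Smx (f m) (g m)) (d m)).
  by have [ex real _] := spec m; apply: second_eigP.
exists (fun m => second_eig (Smx (f m) (g m)) (d m)); split=> // eps eps_gt0.
have eps2_gt0 : 0 < eps / 2 by rewrite divr_gt0.
have [M1 hM1] := hdf _ eps2_gt0; have [M2 hM2] := hdg _ eps2_gt0.
exists (maxn M1 M2) => m; rewrite geq_max => /andP[/hM1 lt1 /hM2 lt2].
have q_gt0 : 0 < #|F m|%:R :> algC by rewrite ltr0n ltnW ?finNzRing_gt1.
have [_ _ bound] := spec m; have [ev ne_d _] := lamP m.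
rewrite [eps]splitr; apply: le_lt_trans (ltrD lt1 lt2).
rewrite ler_pdivrMr ?exprn_gt0 //; apply: le_trans (bound _ ev ne_d) _.
(* In terms of [s], the bound on the eigenvalue equals [q ^ 2] times the sum of the two quotients
   already made small. *)
move: (q_gt0); rewrite -[#|F m|%:R]sqrtCK; set s := sqrtC _ => s2_gt0.
have nz_s : s != 0 by apply: contraTneq s2_gt0 => ->; rewrite expr0n ltxx.
rewrite sqrCK ?sqrtC_ge0 ?(ltW q_gt0) //.
rewrite le_eqVlt; apply/orP; left; apply/eqP.
by field.
Qed.
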